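(* Assume $1<s=|\chi(a)|<|\chi|=\bar s<\infty$ and write $\bar s=ss'$. Let $\xi\in k$ be a root of unity of order $s'$. Let $n,t\ge1$, $\sigma,\lambda\in\hat G$, $\alpha,\beta\in k^\times$; choose $\theta,\eta\in k$ with $\theta^{s'}=\alpha$, $\eta^{s'}=\beta$, and for $1\le j\le s'$ put $\alpha_j=(\theta\lambda(a)^s+\eta\xi^{j-1})^{s'}$. Then: (1) if $\beta+(-1)^{s'+1}\alpha\lambda(a)^{\bar s}\ne0$, then $$V_n(\sigma,\alpha)\otimes V_t(\lambda,\beta)\cong\bigoplus_{i=1}^{\min\{n,t\}}\bigoplus_{j=1}^{s'}s\,V_{2i-1+|n-t|}(\sigma\lambda,\alpha_j);$$ (2) if $\beta+(-1)^{s'+1}\alpha\lambda(a)^{\bar s}=0$, then there is a unique $j_0$ with $1\le j_0\le s'$ and $\alpha_{j_0}=0$, and $$V_n(\sigma,\alpha)\otimes V_t(\lambda,\beta)\cong\Big(\bigoplus_{i=1}^{\min\{n,t\}}\bigoplus_{1\le j\le s',j\ne j_0}s\,V_{2i-1+|n-t|}(\sigma\lambda,\alpha_j)\Big)\oplus\Big(\bigoplus_{i=1}^{\min\{n,t\}}\bigoplus_{j=0}^{\bar s-1}V_{(2i-1+|n-t|)s}(\chi^j\sigma\lambda)\Big).$$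
   Context: Let $k$ be an algebraically closed field of characteristic zero, $G$ a group, $a$ a central element of $G$, $\hat G$ the group of characters $G\to k^\times$, and $\chi\in\hat G$ with $\chi(a)\ne1$. $H=kG(\chi^{-1},a,0)$ is the Hopf algebra generated by the group $G$ and $x$ with $xg=\chi^{-1}(g)gx$ ($g\in G$), $\Delta(g)=g\otimes g$, $\Delta(x)=x\otimes a+1\otimes x$; tensor products of $H$-modules: $g(m\otimes n)=gm\otimes gn$, $x(m\otimes n)=xm\otimes an+m\otimes xn$. For $\lambda\in\hat G$, $t\ge1$, $V_t(\lambda)$ has basis $m_0,\dots,m_{t-1}$ with $gm_i=\chi^i(g)\lambda(g)m_i$, $xm_i=m_{i+1}$ ($i\le t-2$), $xm_{t-1}=0$. With $|\chi|=\bar s$, for $\lambda\in\hat G$, $\beta\in k$, $t\ge1$, $V_t(\lambda,\beta)$ has basis $m_0,\dots,m_{t\bar s-1}$ with $gm_i=\chi^i(g)\lambda(g)m_i$, $xm_i=m_{i+1}$ ($i\le t\bar s-2$), $xm_{t\bar s-1}=\sum_{j=0}^{t-1}\alpha_jm_{j\bar s}$ where $(Y-\beta)^t=Y^t-\sum_{j=0}^{t-1}\alpha_jY^j$. $rM$ denotes the direct sum of $r$ copies of $M$. *)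

(* Defs.v *)
From HB Require Import structures.
From mathcomp Require Import all_boot all_order all_algebra.
From mathcomp Require Import monoid.
From mathcomp Require Import mxtens.
Set Implicit Arguments. Unset Strict Implicit. Unset Printing Implicit Defensive.
Import Order.TTheory GRing.Theory.
Local Open Scope ring_scope.

Section HDefs.
Variables (k : fieldType) (G : groupType).

(* A character of G: a group homomorphism G -> k^x (values are automatically
   units since f g * f g^-1 = f 1 = 1). *)
Definition is_character (f : G -> k) : Prop :=
  (forall g h : G, f (g * h)%g = f g * f h) /\ f 1%g = 1.

Definition char_order (f : G -> k) (n : nat) : Prop :=
  (0 < n)%N /\ (forall g, f g ^+ n = 1) /\
  (forall m, (0 < m < n)%N -> exists g, f g ^+ m != 1).

Definition char_mul (f h : G -> k) : G -> k := fun g => f g * h g.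
Definition char_exp (f : G -> k) (j : nat) : G -> k := fun g => f g ^+ j.

(* A finite-dimensional H-module, H = kG(chi^-1, a, 0), given by matrices in a
   chosen basis (column convention: column i of a matrix is the image of m_i).
   [hrho g] is the action of g, [hx] the action of x. *)
Record hmod := HMod {
  hdim : nat;
  hrho : G -> 'M[k]_hdim;
  hx : 'M[k]_hdim
}.

Definition is_hmod (chi : G -> k) (M : hmod) : Prop :=
  hrho M 1%g = 1%:M /\
  (forall g h, hrho M (g * h)%g = hrho M g *m hrho M h) /\
  (forall g, hx M *m hrho M g = (chi g)^-1 *: (hrho M g *m hx M)).

Definition hiso (M N : hmod) : Prop :=
  exists (P : 'M[k]_(hdim N, hdim M)) (Q : 'M[k]_(hdim M, hdim N)),
    [/\ P *m Q = 1%:M, Q *m P = 1%:M,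
        (forall g, P *m hrho M g = hrho N g *m P)
      & P *m hx M = hx N *m P].

(* Tensor product via the coproduct Delta(g) = g (x) g, Delta(x) = x (x) a + 1 (x) x *)
Definition htens (a : G) (M N : hmod) : hmod :=
  @HMod (hdim M * hdim N)
    (fun g => hrho M g *t hrho N g)
    (hx M *t hrho N a + 1%:M *t hx N).

Definition hzero : hmod := @HMod 0 (fun _ => 0) 0.
Definition hdsum (M N : hmod) : hmod :=
  @HMod (hdim M + hdim N)
    (fun g => block_mx (hrho M g) 0 0 (hrho N g))
    (block_mx (hx M) 0 0 (hx N)).
Definition hbigsum (s : seq hmod) : hmod := foldr hdsum hzero s.
Definition hcopies (r : nat) (M : hmod) : hmod := hbigsum (nseq r M).

(* V_t(lambda): basis m_0..m_{t-1}, g m_i = chi^i(g) lambda(g) m_i,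
   x m_i = m_{i+1}, x m_{t-1} = 0 *)
Definition Vmod (chi lam : G -> k) (t : nat) : hmod :=
  @HMod t
    (fun g => \matrix_(i < t, j < t) ((i == j)%:R * (chi g ^+ i * lam g)))
    (\matrix_(i < t, j < t) (i == j.+1 :> nat)%:R).

(* coefficients alpha_j with (Y - beta)^t = Y^t - sum_{j<t} alpha_j Y^j *)
Definition Valpha (beta : k) (t j : nat) : k := - (('X - beta%:P) ^+ t)`_j.

(* V_t(lambda, beta), with sbar = |chi|: basis m_0..m_{t sbar - 1},
   g m_i = chi^i(g) lambda(g) m_i, x m_i = m_{i+1} (i <= t sbar - 2),
   x m_{t sbar - 1} = sum_{j<t} alpha_j m_{j sbar}. *)
Definition Vmod2 (chi lam : G -> k) (sbar : nat) (beta : k) (t : nat) : hmod :=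
  @HMod (t * sbar)
    (fun g => \matrix_(i < t * sbar, j < t * sbar)
                 ((i == j)%:R * (chi g ^+ i * lam g)))
    (\matrix_(i < t * sbar, j < t * sbar)
       (if (j.+1 < t * sbar)%N then (i == j.+1 :> nat)%:R
        else if (sbar %| i)%N then Valpha beta t (i %/ sbar) else 0)).

End HDefs.

(* Main.v *)
Require Import Defs.
From HB Require Import structures.
From mathcomp Require Import all_boot all_order all_algebra.
From mathcomp Require Import monoid mxtens.
From mathcomp Require Import ring lra zify.
From mathcomp Require Import separable cyclotomic cyclic.
Import GRing.Theory.
Local Open Scope ring_scope.

(* Take generators [m_0], [n_0] of the two factors. As a space, the tensor product [T] is a
   quotient of [k[u, v]], [u^i v^j] going to [m_i (x) n_j]; [x] acts by the q-shift
   [Xop f = lam(a) u f(u, q v) + v f], with [q = chi(a)] of order [s]. By the q-binomial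
   theorem [Xop^s] is multiplication by [S = lam(a)^s U + W], where [U = u^s] and [W = v^s].
   On the part of [k[U, W]] where [U] is near [theta] and [W] near [z = eta xi^(j-1)], [S]
   equals [c0 = lam(a)^s theta + z] plus a nilpotent sum [F + H] with [F^n = H^t = 0], and the
   strong Lefschetz property of [k[F, H]/(F^n, H^t)] gives Jordan blocks of sizes
   [2 i - 1 + |n - t|] for [F + H], generated by forms [w_j]. The weights of [G] are the degrees
   mod [s s']; projecting [u^r w_j] to its homogeneous components yields vectors spanning
   copies of [V_d(sigma lam, c0^s')] when [c0 <> 0] and of [V_(d s)(chi^i sigma lam)] when
   [c0 = 0]. Together they span [T], and the dimensions add up, so the map from the direct sum
   to [T] is an isomorphism. *)

Set Implicit Arguments. Unset Strict Implicit. Unset Printing Implicit Defensive.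

(** * Lefschetz property of truncated polynomial rings *)

Section SparsePolynomials.
Variables (k : fieldType) (k_char0 : [pchar k] =i pred0).

Lemma natr_neq0 n : (0 < n)%N -> n%:R != 0 :> k.
Proof. by move: k_char0 => /pcharf0P ->; rewrite lt0n. Qed.

(** By induction on the number of terms: for [i] in the support, the operator [X d/dX - i] kills the
    term of degree [i] and lowers the order of the zero at [c] by at most one, so it sends [q] to
    [0]. Then [q] is a monomial, and a nonzero monomial does not vanish at [c]. *)
Lemma sparse_multiplicity (c : k) (I : seq nat) (q : {poly k}) : c != 0 ->
  (forall i, i \notin I -> q`_i = 0) -> ('X - c%:P) ^+ size I %| q -> q = 0.
Proof.
move=> c0; elim: I q => [|i I IH] q qI dq; first by apply/polyP=> i; rewrite qI ?coef0.
have Dq : 'X * q^`() - i%:R *: q = 0.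
  apply: IH => [l lI|].
    rewrite coefB coefZ coefXM; case: l lI => [|l] lI /=.
      case: (eqVneq i 0%N) => [->|i0]; first by rewrite mul0r subrr.
      by rewrite qI ?mulr0 ?subrr // in_cons negb_or eq_sym i0.
    rewrite coef_deriv -[q`_l.+1 *+ _]mulr_natl -mulrBl.
    case: (eqVneq l.+1 i) => [->|li]; first by rewrite subrr mul0r.
    by rewrite qI ?mulr0 // in_cons negb_or li.
  move: dq => /dvdpP [p ->] /=.
  rewrite derivM deriv_exp exprS derivB derivX derivC subr0 mul1r /=.
  apply/dvdpP.
  exists ('X * (p^`() * ('X - c%:P) + p *+ (size I).+1) - i%:R *: (p * ('X - c%:P))).
  rewrite -!mul_polyC /=; ring.
(* In characteristic zero [X d/dX] has the pairwise distinct eigenvalues [l] on the monomials [X^l],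
   so its [i]-eigenspace is spanned by [X^i]. *)
have qX : q = q`_i *: 'X^i.
  apply/polyP=> l; rewrite coefZ coefXn.
  case: (eqVneq l i) => [->|li]; first by rewrite mulr1.
  move/polyP/(_ l): Dq; rewrite coefB coefZ coefXM coef0 mulr0.
  have -> : (if l == 0%N then 0 else q^`()`_l.-1) = l%:R * q`_l.
    by case: (l) => [|l'] /=; rewrite ?mul0r // coef_deriv mulr_natl.
  move/eqP; rewrite -mulrBl mulf_eq0 => /orP [|/eqP //].
  case: (ltngtP l i) li => // h _.
    by rewrite -opprB oppr_eq0 -natrB ?(ltnW h) // (negbTE (natr_neq0 _)) // subn_gt0.
  by rewrite -natrB ?(ltnW h) // (negbTE (natr_neq0 _)) // subn_gt0.
have : root q c by rewrite -dvdp_XsubCl (dvdp_trans _ dq) // exprS dvdp_mulr.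
rewrite rootE {1}qX hornerZ hornerXn mulf_eq0 expf_eq0 (negbTE c0) andbF orbF => /eqP qi.
by rewrite qX qi scale0r.
Qed.

(* The kernel of a (j+1) x j matrix, read through [sparse_multiplicity]:
   [(X + 1)^d p] has at most [d + 1] nonzero coefficients. *)
Lemma lefschetz_poly (n t j : nat) : (j < n)%N -> (j < t)%N ->
  exists p : {poly k}, [/\ (size p <= j.+1)%N, p.[-1] != 0 &
    forall i, (i < n)%N -> (n <= i + j)%N -> (('X + 1) ^+ (n + t - 1 - 2 * j) * p)`_i = 0].
Proof.
move=> jn jt; set d := (_ - _)%N.
(* Rows are the [j + 1] unknown coefficients of [p], columns the [j] degrees [n - j, ..., n - 1] in
   which the product has to vanish. *)
pose A : 'M[k]_(j.+1, j) := \matrix_(a < j.+1, b < j) (('X + 1) ^+ d * 'X^a)`_(n - j + b).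
have: kermx A != 0 by rewrite kermx_eq0 /row_free neq_ltn ltnS rank_leq_col.
move=> /rowV0Pn [w /sub_kermxP wA w0].
have [p [sp pw p0]] : exists p : {poly k}, [/\ (size p <= j.+1)%N,
     p = \sum_(a < j.+1) w 0 a *: 'X^a & p != 0].
  exists (rVpoly w); split.
  - exact: size_poly.
  - by rewrite /rVpoly poly_def; apply: eq_bigr => a _; rewrite valK.
  - by apply: contra_neq w0 => w0; rewrite -(rVpolyK w) w0 linear0.
have van i : (i < n)%N -> (n <= i + j)%N -> (('X + 1) ^+ d * p)`_i = 0.
  move=> i1 i2; have ib : (i - (n - j) < j)%N by lia.
  move/rowP/(_ (Ordinal ib)): wA; rewrite !mxE => wA.
  rewrite -[RHS]wA pw mulr_sumr coef_sum; apply: eq_bigr => a _.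
  by rewrite mxE -scalerAr coefZ /=; congr (_ * _`_ _); lia.
exists p; split => //; apply/negP => p1.
have X1 : 'X + 1 = 'X - (-1)%:P :> {poly k} by rewrite polyCN opprK.
have dp : ('X + 1) %| p by rewrite X1 dvdp_XsubCl.
(* A root of [p] at [-1] would make [(X + 1)^(d + 1)] divide a polynomial supported on [[0, n - j)]
   and [[n, n + t - j)], which are only [d + 1] degrees. *)
suff q0 : ('X + 1) ^+ d * p = 0.
  move/eqP: q0; rewrite mulf_eq0 (negbTE p0) orbF expf_eq0 => /andP [_].
  by rewrite X1 polyXsubC_eq0.
apply: (@sparse_multiplicity (-1) (iota 0 (n - j) ++ iota n (t - j))).
- by rewrite oppr_eq0 oner_eq0.
- move=> i; rewrite mem_cat !mem_iota => ni.
  case: (ltnP i n) => h; first by apply: van => //; lia.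
  apply: nth_default; apply: (leq_trans (size_polyMleq _ _)).
  have := size_polyMleq ('X + 1) p.
  have : (size (('X + 1) ^+ d : {poly k})%R <= d.+1)%N.
    by apply: (leq_trans (size_poly_exp_leq _ _)); rewrite X1 size_XsubC /= mul1n.
  set sd := size _; lia.
- rewrite size_cat !size_iota -X1.
  have -> : (n - j + (t - j) = d.+1)%N by rewrite /d; lia.
  by rewrite exprS mulrC dvdp_mul2l // expf_eq0 X1 polyXsubC_eq0 andbF.
Qed.

End SparsePolynomials.

(** * Linear subspaces as predicates *)

Section Subspaces.
Variables (k : fieldType) (C : comNzRingType) (iota : {rmorphism k -> C}).

(** Scalars act through [iota]. With subspaces as predicates, a spanning statement becomes an
    induction principle. *)
Definition subspace (L : C -> Prop) : Prop :=
  L 0 /\ forall c x y, L x -> L y -> L (iota c * x + y).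

Variable L : C -> Prop.
Hypothesis sL : subspace L.

Lemma sub_add x y : L x -> L y -> L (x + y).
Proof. by move=> Lx Ly; rewrite -[x]mul1r -(rmorph1 iota); apply: sL.2. Qed.

Lemma sub_scale c x : L x -> L (iota c * x).
Proof. by move=> Lx; rewrite -[_ * _]addr0; apply: sL.2 => //; apply: sL.1. Qed.

Lemma sub_opp x : L x -> L (- x).
Proof. by rewrite -mulN1r -(rmorph1 iota) -rmorphN; apply: sub_scale. Qed.

Lemma sub_sub x y : L x -> L y -> L (x - y).
Proof. by move=> Lx Ly; apply: sub_add => //; apply: sub_opp. Qed.

Lemma sub_scaleI c x : c != 0 -> L (iota c * x) -> L x.
Proof.
move=> c0 /(sub_scale c^-1); rewrite mulrA -rmorphM mulVf //.
by rewrite rmorph1 mul1r.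
Qed.

Lemma sub_sum (I : Type) (r : seq I) (P : pred I) (f : I -> C) :
  (forall i, P i -> L (f i)) -> L (\sum_(i <- r | P i) f i).
Proof. by move=> Lf; elim/big_ind: _ => //; [apply: sL.1 | apply: sub_add]. Qed.

End Subspaces.

(** * Binary forms and multiplication by [F + H] *)

Section Lefschetz.
Variables (k : fieldType) (C : comNzRingType) (iota : {rmorphism k -> C}).
Implicit Types (p : {poly k}) (F H : C).

(** The form of degree [j] with dehomogenization [p], that is [H^j p(F / H)]; multiplying [p] by
    [X + 1] multiplies the form by [F + H]. *)
Definition homog p j F H : C := \sum_(i < j.+1) iota p`_i * F ^+ i * H ^+ (j - i).

Lemma homogM p j F H : (size p <= j.+1)%N ->
  homog (('X + 1) * p) j.+1 F H = (F + H) * homog p j F H.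
Proof.
move=> sp; rewrite /homog [RHS]mulrDl !mulr_sumr.
pose f i := iota p`_i * F ^+ i * H ^+ (j.+1 - i).
have -> : \sum_(i < j.+1) H * (iota p`_i * F ^+ i * H ^+ (j - i)) = \sum_(i < j.+2) f i.
  rewrite [RHS]big_ord_recr /= /f nth_default // rmorph0 !mul0r addr0.
  by apply: eq_bigr => i _; rewrite subSn 1?exprS -1?ltnS //; ring.
pose g i := if i is i'.+1 then iota p`_i' * F ^+ i * H ^+ (j.+1 - i) else 0.
have -> : \sum_(i < j.+1) F * (iota p`_i * F ^+ i * H ^+ (j - i)) = \sum_(i < j.+2) g i.
  rewrite [RHS]big_ord_recl /= add0r.
  by apply: eq_bigr => i _; rewrite subSS exprS; ring.
rewrite -big_split; apply: eq_bigr => i _ /=.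
rewrite mulrDl mul1r coefD coefXM rmorphD /f /g.
by case: (nat_of_ord i) => [|i'] /=; rewrite ?rmorph0; ring.
Qed.

Lemma homogMX p j d F H : (size p <= j.+1)%N ->
  homog (('X + 1) ^+ d * p) (d + j) F H = (F + H) ^+ d * homog p j F H.
Proof.
move=> sp; elim: d => [|d IH]; first by rewrite !mul1r.
rewrite !exprS -!mulrA -IH addSn homogM //.
apply: (leq_trans (size_polyMleq _ _)).
have := size_poly_exp_leq ('X + 1 : {poly k}) d.
rewrite -[in X in (_ <= X)%N]polyC1 size_XaddC /= mul1n.
set x := size _; clearbody x; move: sp; set y := size _; clearbody y; lia.
Qed.

(** The product has degree [n + t - 1 - j]. Its coefficients at [F^i] with [n - j <= i < n] vanish
    by hypothesis; for [i >= n] the power [F^n] divides the term, and for [i < n - j] the exponent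
    of [H] is at least [t]. *)
Lemma homog_annihilated p n t j F H : (j < n)%N -> (j < t)%N -> (size p <= j.+1)%N ->
  (forall i, (i < n)%N -> (n <= i + j)%N -> (('X + 1) ^+ (n + t - 1 - 2 * j) * p)`_i = 0) ->
  exists y z, (F + H) ^+ (n + t - 1 - 2 * j) * homog p j F H = y * F ^+ n + z * H ^+ t.
Proof.
move=> jn jt sp van; rewrite -homogMX //.
have Ft i : exists y z, iota (('X + 1) ^+ (n + t - 1 - 2 * j) * p)`_i * F ^+ i
    * H ^+ (n + t - 1 - 2 * j + j - i) = y * F ^+ n + z * H ^+ t.
  case: (leqP n i) => ni.
    rewrite -[X in F ^+ X](subnK ni) exprD.
    set c := iota _; set h := H ^+ _.
    by exists (c * F ^+ (i - n) * h), 0; ring.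
  case: (leqP n (i + j)) => nij.
    by rewrite van // rmorph0; exists 0, 0; ring.
  have tj : (t <= n + t - 1 - 2 * j + j - i)%N by lia.
  rewrite -[X in H ^+ X](subnK tj) exprD; set c := iota _; set h := H ^+ _.
  by exists 0, (c * F ^+ i * h); ring.
rewrite /homog; elim/big_ind: _ => [|x x' [y [z ->]] [y' [z' ->]]|i _]; last exact: Ft.
  by exists 0, 0; ring.
by exists (y + y'), (z + z'); ring.
Qed.

(* Modulo [F + H] a form of degree [j] is a multiple of [H ^+ j], and [homog p j F H] is
   [p.[-1] H ^+ j] up to sign; so the span is everything by induction on the degree. *)
Lemma lefschetz_span (L : C -> Prop) n t F H (p : nat -> {poly k}) :
  subspace iota L -> (forall x, L x -> L ((F + H) * x)) ->
  (forall a b, (n <= a)%N || (t <= b)%N -> L (F ^+ a * H ^+ b)) ->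
  (forall j, (j < n)%N -> (j < t)%N ->
     [/\ (size (p j) <= j.+1)%N, (p j).[-1] != 0 & L (homog (p j) j F H)]) ->
  forall a b, L (F ^+ a * H ^+ b).
Proof.
move=> sL LN LI Lp a b; move: {2}(a + b)%N (erefl (a + b)%N) => e.
elim: e a b => [|e IH] a b.
  case: a b => [|a] [|b] // _.
  case: (posnP n) => [n0|n0]; first by have := LI 0%N 0%N; rewrite n0; apply.
  case: (posnP t) => [t0|t0]; first by have := LI 0%N 0%N; rewrite t0 orbT; apply.
  have [s1 p1] := Lp _ n0 t0; rewrite /homog big_ord1 !expr0 !mulr1.
  move/size1_polyC: s1 p1 => ->; rewrite hornerC coefC /= => c0 Lc.
  by apply: (sub_scaleI sL c0); rewrite mulr1.
move=> abe.
(* Modulo [F + H], [F] equals [- H]; the lower degrees are already in [L], and [L] is stable under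
   [F + H]. *)
have cong i : (i <= e.+1)%N -> L (F ^+ i * H ^+ (e.+1 - i) - iota ((-1) ^+ i) * H ^+ e.+1).
  elim: i => [|i IHi] ie; first by rewrite subn0 mul1r rmorph1 mul1r subrr; apply: sL.1.
  have h : L (F ^+ i * H ^+ (e - i)) by apply: IH; lia.
  have := sub_sub sL (LN _ h) (IHi (ltnW ie)).
  rewrite subSS subSn // !exprS rmorphM rmorphN rmorph1.
  by congr L; ring.
(* It remains to reach [H^(e + 1)]: from [F^(e + 1)] if [n <= e + 1], directly if [t <= e + 1], and
   otherwise from the form of degree [e + 1], which is congruent to a nonzero multiple of it. *)
suff LH : L (H ^+ e.+1).
  have := sub_add sL (cong a _) (sub_scale sL ((-1) ^+ a) LH).
  rewrite subrK (_ : e.+1 - a = b)%N; last by lia.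
  by apply; lia.
have sgn i : (-1) ^+ i != 0 :> k by rewrite signr_eq0.
case: (leqP n e.+1) => en.
  have := sub_sub sL (LI e.+1 0%N _) (cong e.+1 _); rewrite en => /(_ isT (leqnn _)).
  rewrite subnn => h; apply: (sub_scaleI sL (sgn e.+1)).
  by move: h; congr L; ring.
case: (leqP t e.+1) => et.
  by have := LI 0%N e.+1; rewrite et orbT mul1r; apply.
have [s1 p1 Lh] := Lp _ en et.
apply: (sub_scaleI sL p1).
have <- : homog (p e.+1) e.+1 F H - \sum_(i < e.+2) iota (p e.+1)`_i *
    (F ^+ i * H ^+ (e.+1 - i) - iota ((-1) ^+ i) * H ^+ e.+1) = iota (p e.+1).[-1] * H ^+ e.+1.
  rewrite -sumrB (horner_coef_wide _ s1) rmorph_sum mulr_suml.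
  by apply: eq_bigr => i _; rewrite rmorphM; ring.
apply: (sub_sub sL Lh); apply: (sub_sum sL) => i _.
by apply: (sub_scale sL); apply: cong; rewrite -ltnS.
Qed.

End Lefschetz.

(** * Criteria for ideals and subspaces of [k[X]] to be everything *)

Section PolynomialSubspaces.
Variables (k : closedFieldType).
Implicit Types (p g : {poly k}).

(* The roots of a nonzero element of [J] can be divided off one at a time. *)
Lemma ideal_without_roots (J : {poly k} -> Prop) :
  (forall p g, J p -> J g -> J (p + g)) -> (forall g p, J p -> J (g * p)) ->
  (exists2 p, p != 0 & J p) -> (forall z, exists2 g, J g & g.[z] != 0) -> J 1.
Proof.
move=> JD JM [p p0 Jp] Jz; move: {2}(size p) (leqnn (size p)) => m.
elim: m p p0 Jp => [|m IH] p p0 Jp sp.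
  by move: sp; rewrite leqn0 size_poly_eq0 (negbTE p0).
case: (boolP (size p == 1%N)) => [/size_poly1P [c c0 pc]|/closed_rootP [z]].
  by have := JM c^-1%:P _ Jp; rewrite pc -polyCM mulVf.
rewrite -dvdp_XsubCl => /dvdpP [p' pE].
have p'0 : p' != 0 by apply: contra_neq p0 => p'0; rewrite pE p'0 mul0r.
have [g Jg gz] := Jz z; apply: (IH p') => //; last first.
  by move: sp; rewrite pE size_Mmonic ?monicXsubC // size_XsubC addn2.
(* With [g = g(z) + h (X - z)] and [p = p' (X - z)], the combination [p' g - h p] equals [g(z) p'],
   so [p'] lies in [J]. *)
have /dvdpP [h hE] : 'X - z%:P %| g - g.[z]%:P.
  by rewrite dvdp_XsubCl rootE hornerD hornerN hornerC subrr.
have -> : p' = g.[z]^-1%:P * (p' * g + - h * p).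
  have {2}-> : g = g.[z]%:P + h * ('X - z%:P) by rewrite -hE addrC subrK.
  rewrite pE; set c := g.[z]%:P.
  have -> : p' * (c + h * ('X - z%:P)) + - h * (p' * ('X - z%:P)) = c * p' by ring.
  by rewrite mulrA -polyCM mulVf // mul1r.
by apply: (JM); apply: (JD); apply: (JM).
Qed.

(** Elements of order exactly [i] at [c0], one for each [i], form a triangular system modulo
    [(X - c0)^d]. Here [L] need only be a subspace, not an ideal. *)
Lemma adic_span (L : {poly k} -> Prop) (c0 : k) d :
  subspace (@polyC k : {rmorphism k -> {poly k}}) L ->
  (forall f, L (('X - c0%:P) ^+ d * f)) ->
  (forall i, exists2 e, e.[c0] != 0 & L (('X - c0%:P) ^+ i * e)) -> forall f, L f.
Proof.
move=> sL Ld Le f; suff: forall i f, (i <= d)%N -> L (('X - c0%:P) ^+ (d - i) * f).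
  by move=> /(_ d f (leqnn _)); rewrite subnn mul1r.
elim=> [|i IH] {}f id; first by rewrite subn0.
have [e e0 Lie] := Le (d - i.+1)%N.
have /dvdpP [h hE] : 'X - c0%:P %| f - (f.[c0] / e.[c0])%:P * e.
  by rewrite dvdp_XsubCl rootE !hornerE divfK // subrr.
have -> : f = (f.[c0] / e.[c0])%:P * e + h * ('X - c0%:P) by rewrite -hE addrC subrK.
rewrite mulrDr mulrCA; apply: (sub_add sL); first exact: (sub_scale sL).
have := IH h (ltnW id); rewrite -subSS subSn // exprS; congr L; ring.
Qed.

End PolynomialSubspaces.

(** * The twisted shift on polynomials in two variables *)

Lemma prim_root_neq0 (k : fieldType) n (z : k) : n.-primitive_root z -> z != 0.
Proof.
move=> zn; apply/negP => /eqP z0; move: (prim_expr_order zn).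
by rewrite z0 expr0n gtn_eqF ?(prim_order_gt0 zn) // => /eqP; rewrite eq_sym oner_eq0.
Qed.

(** * Gaussian binomial coefficients at a root of unity *)

Section GaussianBinomials.
Variables (k : fieldType) (q : k).

Fixpoint gbinom (m j : nat) : k :=
  match m, j with
  | _, 0 => 1
  | 0, _.+1 => 0
  | m'.+1, j'.+1 => gbinom m' j' + q ^+ j'.+1 * gbinom m' j'.+1
  end.

Lemma gbinom0 m : gbinom m 0 = 1. Proof. by case: m. Qed.

Lemma gbinom_small m j : (m < j)%N -> gbinom m j = 0.
Proof.
elim: m j => [|m IH] [|j] //= mj; rewrite !IH ?mulr0 ?addr0 //; lia.
Qed.

Lemma gbinomnn m : gbinom m m = 1.
Proof. by elim: m => //= m ->; rewrite gbinom_small // mulr0 addr0. Qed.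

(** The [q]-analogue of [(j + 1) C(m, j + 1) = (m - j) C(m, j)], cleared of denominators so that it
    holds at roots of unity. *)
Lemma gbinom_step m j :
  q ^+ j * (q ^+ j.+1 - 1) * gbinom m j.+1 = (q ^+ m - q ^+ j) * gbinom m j.
Proof.
elim: m j => [|m IH] [|j] //=.
- by rewrite subrr; ring.
- by rewrite !mulr0.
- have := IH 0%N; rewrite gbinom0 !expr0 !exprS expr0; move: (gbinom m 1) => y h.
  rewrite mulr1 mul1r in h; transitivity ((q - 1) + q * ((q - 1) * y)); first by ring.
  by rewrite -[q - 1 in X in _ + q * X](mulr1) mulr1 h; ring.
have h1 := IH j; have h2 := IH j.+1; move: h1 h2.
rewrite !exprS; set a := q ^+ j; set b := q ^+ m.
move: (gbinom m j) (gbinom m j.+1) (gbinom m j.+2) => x y z h1 h2.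
have -> : q * a * (q * (q * a) - 1) * (y + q * (q * a) * z) =
   q * a * (q * (q * a) - 1) * y + q * (q * a) * (q * a * (q * (q * a) - 1) * z) by ring.
have -> : (q * b - q * a) * (x + q * a * y) =
   q * ((b - a) * x) + (q * b - q * a) * (q * a * y) by ring.
by rewrite h2 -h1; ring.
Qed.

(** In [gbinom_step] the right side vanishes, at [j = 0] because [q^s = 1] and then by induction,
    while the factor on the left is nonzero for [j + 1 < s]. *)
Lemma gbinom_prim s j : s.-primitive_root q -> (0 < j < s)%N -> gbinom s j = 0.
Proof.
move=> qs; elim: j => // j IH /andP [_ js].
have q0 := prim_root_neq0 qs.
have := gbinom_step s j.
have -> : (q ^+ s - q ^+ j) * gbinom s j = 0.
  case: j IH js => [|j] IH js; first by rewrite (prim_expr_order qs) subrr mul0r.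
  by rewrite IH ?mulr0 //; lia.
move/eqP; rewrite !mulf_eq0 expf_eq0 (negbTE q0) andbF subr_eq0 /=.
rewrite -(prim_order_dvd qs) => /orP [/dvdn_leq h|/eqP //].
by move: (h isT); rewrite leqNgt js.
Qed.

End GaussianBinomials.

(** * Substitutions [u -> x u], [v -> y v] and the twisted shift *)

Section TwistedShift.
Variables (k : fieldType) (C : comNzRingType) (iota : {rmorphism k -> C}).
Variables (u v : C) (sc : k -> k -> {rmorphism C -> C}).
Hypothesis sc_iota : forall x y c, sc x y (iota c) = iota c.
Hypothesis sc_u : forall x y, sc x y u = iota x * u.
Hypothesis sc_v : forall x y, sc x y v = iota y * v.
Hypothesis uv_span : forall L : C -> Prop, subspace iota L ->
  (forall i j, L (u ^+ i * v ^+ j)) -> forall f, L f.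

Lemma sc_comp x y x' y' f : sc x y (sc x' y' f) = sc (x * x') (y * y') f.
Proof.
move: f; apply: uv_span.
  split=> [|c f g hf hg]; first by rewrite !rmorph0.
  by rewrite !rmorphD !rmorphM !sc_iota hf hg.
by move=> i j; rewrite !(rmorphM, rmorphXn, sc_u, sc_v, sc_iota) /= !exprMn; ring.
Qed.

Lemma sc11 f : sc 1 1 f = f.
Proof.
move: f; apply: uv_span.
  split=> [|c f g hf hg]; first by rewrite !rmorph0.
  by rewrite !rmorphD !rmorphM !sc_iota hf hg.
by move=> i j; rewrite !(rmorphM, rmorphXn, sc_u, sc_v, rmorph1, mul1r).
Qed.

Variables (la q : k).
(** The two terms come from [x (x) a] and [1 (x) x]: [a] scales the [j]-th basis vector of the
    second factor by [la q^j], which is [la] times the substitution [v -> q v]. *)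
Definition Xop (f : C) : C := iota la * u * sc 1 q f + v * f.

Lemma Xop_lin c f g : Xop (iota c * f + g) = iota c * Xop f + Xop g.
Proof. by rewrite /Xop rmorphD rmorphM sc_iota; ring. Qed.

Lemma Xop_scale c f : Xop (iota c * f) = iota c * Xop f.
Proof. by rewrite /Xop rmorphM sc_iota; ring. Qed.

Lemma iterX_lin m c f g :
  iter m Xop (iota c * f + g) = iota c * iter m Xop f + iter m Xop g.
Proof. by elim: m => //= m ->; rewrite Xop_lin. Qed.

Lemma iterX_scale m c f : iter m Xop (iota c * f) = iota c * iter m Xop f.
Proof. by elim: m => //= m ->; rewrite Xop_scale. Qed.

Lemma iterX0 m : iter m Xop 0 = 0.
Proof. by elim: m => //= m ->; rewrite /Xop rmorph0 !mulr0 addr0. Qed.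

Lemma Xop_u f : Xop (u * f) = u * Xop f.
Proof. by rewrite /Xop rmorphM sc_u rmorph1; ring. Qed.

Lemma Xop_homog z f : sc z z (Xop f) = iota z * Xop (sc z z f).
Proof.
rewrite /Xop !(rmorphD, rmorphM) !sc_iota sc_u sc_v !sc_comp mulr1 mul1r [q * z]mulrC; ring.
Qed.

Lemma iterX_homog z f m : sc z z (iter m Xop f) = iota (z ^+ m) * iter m Xop (sc z z f).
Proof.
elim: m => [|m IH] /=; first by rewrite rmorph1 mul1r.
by rewrite Xop_homog IH Xop_scale exprS rmorphM; ring.
Qed.

(** The [q]-binomial theorem: for [P = la u sc 1 q] and [Q] the multiplication by [v], one has
    [P Q = q Q P], and [P^i] is [(la u)^i sc 1 (q^i)]. *)
Lemma iterX_gbinom m f : iter m Xop f =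
  \sum_(j < m.+1) iota (gbinom q m j) * v ^+ j * (iota la * u) ^+ (m - j) * sc 1 (q ^+ (m - j)) f.
Proof.
elim: m => [|m IH] /=.
  by rewrite big_ord1 expr0 sc11 rmorph1; ring.
rewrite IH {1}/Xop rmorph_sum !mulr_sumr /=.
pose w j := (iota la * u) ^+ (m.+1 - j) * sc 1 (q ^+ (m.+1 - j)) f.
pose g j := iota (q ^+ j * gbinom q m j) * v ^+ j * w j.
have -> : \sum_(j < m.+1) iota la * u * sc 1 q (iota (gbinom q m j) * v ^+ j *
     (iota la * u) ^+ (m - j) * sc 1 (q ^+ (m - j)) f) = \sum_(j < m.+2) g j.
  rewrite [RHS]big_ord_recr /= /g gbinom_small // mulr0 rmorph0 !mul0r addr0.
  apply: eq_bigr => j _; have jm : (j <= m)%N by rewrite -ltnS.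
  rewrite /w subSn // !exprS !(rmorphM, rmorphXn) /= sc_comp !(sc_iota, sc_u, sc_v) mulr1 rmorph1.
  by rewrite mul1r exprMn; ring.
pose h j := if j is j'.+1 then iota (gbinom q m j') * v ^+ j * w j else 0.
have -> : \sum_(j < m.+1) v * (iota (gbinom q m j) * v ^+ j *
     (iota la * u) ^+ (m - j) * sc 1 (q ^+ (m - j)) f) = \sum_(j < m.+2) h j.
  rewrite [RHS]big_ord_recl /= add0r; apply: eq_bigr => j _.
  by rewrite /w subSS exprS; ring.
rewrite -big_split /=; apply: eq_bigr => j _; rewrite /g /h /w.
by case: (nat_of_ord j) => [|j'] /=; rewrite ?gbinom0 ?rmorphD; ring.
Qed.

(** The inner Gaussian binomials vanish, and in the term without [v] the substitution [v -> q^s v]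
    is the identity. *)
Lemma iterX_prim s f : s.-primitive_root q ->
  iter s Xop f = (iota (la ^+ s) * u ^+ s + v ^+ s) * f.
Proof.
move=> qs; have s0 := prim_order_gt0 qs.
rewrite iterX_gbinom (bigD1 ord0) // (bigD1 ord_max) /=; last by rewrite -val_eqE /= -lt0n.
rewrite big1 => [|j /andP [j0 js]].
  rewrite addr0 gbinomnn gbinom0 subn0 subnn (prim_expr_order qs) !sc11.
  by rewrite !rmorphXn exprMn rmorph1; ring.
rewrite (gbinom_prim qs) ?rmorph0 ?mul0r // lt0n.
move: j0 js (ltn_ord j); rewrite -!val_eqE /= ltnS => -> js.
by rewrite leq_eqVlt (negbTE js).
Qed.

(** * The grading by total degree modulo [N] *)

Section Projections.
Variables (N : nat) (zeta : k).
Hypothesis zetaN : N.-primitive_root zeta.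

(** Homogeneity of degree [c] is tested on [N]-th roots of unity, so only the class of [c] modulo
    [N] matters. *)
Definition homogc (c : nat) (f : C) : Prop :=
  forall z, z ^+ N = 1 -> sc z z f = iota (z ^+ c) * f.

(** A discrete Fourier transform. It is [N] times the projector onto degree [c]; the factor [1 / N]
    is left out. *)
Definition proj (c : nat) (f : C) : C :=
  \sum_(i < N) iota (zeta^-1 ^+ (c * i)) * sc (zeta ^+ i) (zeta ^+ i) f.

Let zeta0 : zeta != 0.
Proof. exact: prim_root_neq0 zetaN. Qed.

Lemma proj0 c : proj c 0 = 0.
Proof. by rewrite /proj big1 // => i _; rewrite rmorph0 mulr0. Qed.

Lemma proj_lin c a f g : proj c (iota a * f + g) = iota a * proj c f + proj c g.
Proof.
rewrite /proj mulr_sumr -big_split; apply: eq_bigr => i _ /=.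
by rewrite rmorphD rmorphM sc_iota; ring.
Qed.

(** Substituting [zeta] shifts the summation index, and the sum wraps around as [zeta^N = 1]; every
    [N]-th root of unity is a power of [zeta]. *)
Lemma proj_homogc c f : homogc c (proj c f).
Proof.
pose h i := iota (zeta^-1 ^+ (c * i)) * sc (zeta ^+ i) (zeta ^+ i) f.
have step : sc zeta zeta (proj c f) = iota (zeta ^+ c) * proj c f.
  have hs : \sum_(i < N) h i.+1 = proj c f.
    apply: (addrI (h 0%N)); rewrite -(big_ord_recl N h) big_ord_recr addrC.
    congr (_ + _).
    by rewrite /h mulnC exprM exprVn (prim_expr_order zetaN) muln0 invr1 expr1n.
  rewrite -[in RHS]hs rmorph_sum mulr_sumr; apply: eq_bigr => i _.
  rewrite rmorphM sc_iota sc_comp -!exprS /h mulrA -rmorphM mulnS exprD.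
  by rewrite [zeta ^+ c * _]mulrA -exprMn mulfV // expr1n mul1r.
move=> z /(prim_rootP zetaN) [[i _] /= ->].
elim: i => [|i IH]; first by rewrite sc11 expr1n rmorph1 mul1r.
by rewrite exprS -sc_comp IH rmorphM sc_iota step exprMn rmorphM; ring.
Qed.

Lemma homogcM c d f g : homogc c f -> homogc d g -> homogc (c + d) (f * g).
Proof. by move=> hf hg z zN; rewrite rmorphM hf // hg // exprD rmorphM; ring. Qed.

Lemma homogc_u i : homogc i (u ^+ i).
Proof. by move=> z _; rewrite rmorphXn sc_u exprMn rmorphXn. Qed.

Lemma homogc_v i : homogc i (v ^+ i).
Proof. by move=> z _; rewrite rmorphXn sc_v exprMn rmorphXn. Qed.

Lemma homogc_lin c a f g : homogc c f -> homogc c g -> homogc c (iota a * f + g).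
Proof. by move=> hf hg z zN; rewrite rmorphD rmorphM sc_iota hf // hg //; ring. Qed.

Lemma homogc_mod c f : homogc (c + N) f <-> homogc c f.
Proof. by split=> h z zN; move: (h z zN); rewrite exprD zN mulr1. Qed.

Lemma homogc_iterX c m f : homogc c f -> homogc (m + c) (iter m Xop f).
Proof.
by move=> hf z zN; rewrite iterX_homog hf // iterX_scale exprD rmorphM mulrA.
Qed.

Lemma proj_mul e c h f : homogc e h -> proj (e + c) (h * f) = h * proj c f.
Proof.
move=> hh; rewrite /proj mulr_sumr; apply: eq_bigr => i _.
rewrite rmorphM hh; last by rewrite exprAC (prim_expr_order zetaN) expr1n.
rewrite mulnDl exprD rmorphM -exprM; set a := iota (_ ^+ (e * i)).
set b := iota (_ ^+ (i * e)).
have : a * b = 1.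
  by rewrite /a /b -rmorphM mulnC -exprMn mulVf // expr1n rmorph1.
move: (iota _) (sc _ _ f) => x y ab.
by transitivity ((a * b) * (h * (x * y))); [ring | rewrite ab mul1r].
Qed.

Lemma proj_modn c f : proj (c + N) f = proj c f.
Proof.
apply: eq_bigr => i _.
by rewrite mulnDl exprD (exprM _ N) [zeta^-1 ^+ N]exprVn (prim_expr_order zetaN) invr1 expr1n mulr1.
Qed.

Lemma proj_id c f : homogc c f -> proj c f = N%:R * f.
Proof.
move=> hf; have := proj_mul 0 1 hf; rewrite addn0 mulr1 => ->.
rewrite mulrC; congr (_ * _).
rewrite /proj (eq_bigr (fun=> 1)) ?sumr_const ?card_ord // => i _.
by rewrite mul0n !rmorph1 mulr1.
Qed.

Lemma proj_sc c z f : z ^+ N = 1 -> proj c (sc z z f) = iota (z ^+ c) * proj c f.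
Proof.
move=> zN; rewrite -proj_homogc // /proj rmorph_sum; apply: eq_bigr => i _.
by rewrite rmorphM sc_iota !sc_comp ![z * _]mulrC.
Qed.

End Projections.

Definition ev (x : C) : {rmorphism {poly k} -> C} :=
  horner_morph (fun c => mulrC x (iota c)).

Lemma ev_poly x p : ev x p = \sum_(i < size p) iota p`_i * x ^+ i.
Proof.
rewrite -[LHS]/((map_poly iota p).[x]) horner_coef size_map_poly.
by apply: eq_bigr => i _; rewrite coef_map.
Qed.

Lemma evC x c : ev x c%:P = iota c.
Proof. exact: horner_morphC. Qed.

Lemma evX x : ev x 'X = x.
Proof. exact: horner_morphX. Qed.

Lemma evXn x m : ev x 'X^m = x ^+ m.
Proof. by rewrite rmorphXn /= evX. Qed.

Lemma ev_XsubC x c m : ev x (('X - c%:P) ^+ m) = (x - iota c) ^+ m.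
Proof. by rewrite rmorphXn /= rmorphB /= evX evC. Qed.

Lemma ev_XnsubC x c e m : ev x (('X^e - c%:P) ^+ m) = (x ^+ e - iota c) ^+ m.
Proof. by rewrite rmorphXn /= rmorphB rmorphXn /= evX evC. Qed.

Lemma ev_span (L : C -> Prop) x y p : subspace iota L ->
  (forall i, L (x ^+ i * y)) -> L (ev x p * y).
Proof.
move=> sL Lx; rewrite ev_poly mulr_suml; apply: (sub_sum sL) => i _.
by rewrite -mulrA; apply: (sub_scale sL).
Qed.

Lemma ev_comp x p g : ev x (p \Po g) = ev (ev x g) p.
Proof.
rewrite comp_polyE [RHS]ev_poly rmorph_sum; apply: eq_bigr => i _.
by rewrite -mul_polyC rmorphM evC rmorphXn.
Qed.

Lemma ev_affine (L : C -> Prop) a z x y p : subspace iota L -> a != 0 ->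
  (forall i, L ((iota a * (x - iota z)) ^+ i * y)) -> L (ev x p * y).
Proof.
move=> sL a0 Lx; set w := iota a * _ in Lx.
have <- : ev w (p \Po (a^-1 *: 'X + z%:P)) = ev x p.
  rewrite ev_comp rmorphD -mul_polyC rmorphM !evC evX /w mulrA -rmorphM mulVf //.
  by rewrite rmorph1 mul1r subrK.
exact: ev_span.
Qed.

(** The cofactor of [x - y] in [x^m - y^m]. For a scalar [y] it vanishes at the other roots of
    [x^m = y^m] and takes the value [m y^(m - 1)] at [x = y], so its powers isolate the part near
    [y]. *)
Definition geom (m : nat) (x y : C) : C := \sum_(i < m) x ^+ (m.-1 - i) * y ^+ i.

Lemma geom_scale m c x y : geom m (c * x) (c * y) = c ^+ m.-1 * geom m x y.
Proof.
rewrite /geom mulr_sumr; apply: eq_bigr => i _.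
have im : (i <= m.-1)%N by have := ltn_ord i; lia.
by rewrite !exprMn mulrACA -exprD subnK.
Qed.

Definition geomp (m : nat) (z : k) : {poly k} := \sum_(i < m) 'X ^+ (m.-1 - i) * z%:P ^+ i.

Lemma ev_geomp m z x : ev x (geomp m z) = geom m x (iota z).
Proof.
rewrite rmorph_sum; apply: eq_bigr => i _.
by rewrite rmorphM !rmorphXn /= evX evC.
Qed.

Lemma geomp_diag m z : (geomp m z).[z] = m%:R * z ^+ m.-1.
Proof.
rewrite /geomp horner_sum (eq_bigr (fun=> z ^+ m.-1)) ?sumr_const ?card_ord ?mulr_natl // => i _.
rewrite hornerM !horner_exp hornerX hornerC -exprD subnK //; have := ltn_ord i; lia.
Qed.

Lemma geompM m z : ('X - z%:P) * geomp m z = 'X^m - (z ^+ m)%:P.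
Proof. by rewrite -subrXX polyC_exp. Qed.

Lemma geomM m x y : (x - y) * geom m x y = x ^+ m - y ^+ m.
Proof. by rewrite -subrXX. Qed.

End TwistedShift.

(** * Generators of the components near [U = theta], [W = z] *)

Section Components.
Variables (k : closedFieldType) (k_char0 : [pchar k] =i pred0).
Variables (C : comNzRingType) (iota : {rmorphism k -> C}).
Variables (u v : C) (sc : k -> k -> {rmorphism C -> C}).
Hypothesis sc_iota : forall x y c, sc x y (iota c) = iota c.
Hypothesis sc_u : forall x y, sc x y u = iota x * u.
Hypothesis sc_v : forall x y, sc x y v = iota y * v.
Hypothesis uv_span : forall L : C -> Prop, subspace iota L ->
  (forall i j, L (u ^+ i * v ^+ j)) -> forall f, L f.
Variables (la q zeta : k) (s s' n t : nat).
Hypothesis la0 : la != 0.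
Hypothesis qs : s.-primitive_root q.
Hypothesis zetaN : (s * s').-primitive_root zeta.
Variables (theta eta : k).
Hypotheses (theta0 : theta != 0) (eta0 : eta != 0).

Local Notation X := (Xop iota u v sc la q).
Local Notation U := (u ^+ s).
Local Notation W := (v ^+ s).
Local Notation A := (u ^+ (s * s') - iota (theta ^+ s')).
Local Notation B := (v ^+ (s * s') - iota (eta ^+ s')).
Local Notation S := (iota (la ^+ s) * U + W).
Local Notation pr := (proj iota sc (s * s') zeta).
Local Notation hom := (homogc iota sc (s * s')).
Local Notation ev := (ev iota).
Local Notation geom := (geom s').

(** The ideal of relations of the tensor product: [A^n] and [B^t] express the defining relations of
    the two factors. *)
Definition inI (f : C) : Prop := exists x y, f = A ^+ n * x + B ^+ t * y.

Let s0 : (0 < s)%N. Proof. exact: prim_order_gt0 qs. Qed.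
Let N0 : (0 < s * s')%N. Proof. exact: prim_order_gt0 zetaN. Qed.
Let s'0 : (0 < s')%N. Proof. by move: N0; rewrite muln_gt0 => /andP []. Qed.

Lemma sc_A x y m : x ^+ (s * s') = 1 -> sc x y (A ^+ m) = A ^+ m.
Proof.
by move=> xN; rewrite rmorphXn rmorphB [sc x y (u ^+ _)]rmorphXn sc_u sc_iota exprMn -rmorphXn xN rmorph1 mul1r.
Qed.

Lemma sc_B x y m : y ^+ (s * s') = 1 -> sc x y (B ^+ m) = B ^+ m.
Proof.
by move=> xN; rewrite rmorphXn rmorphB [sc x y (v ^+ _)]rmorphXn sc_v sc_iota exprMn -rmorphXn xN rmorph1 mul1r.
Qed.

Lemma hom_A m : hom 0 (A ^+ m).
Proof. by move=> z zN; rewrite sc_A // rmorph1 mul1r. Qed.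

Lemma hom_B m : hom 0 (B ^+ m).
Proof. by move=> z zN; rewrite sc_B // rmorph1 mul1r. Qed.

Lemma inI_M x f : inI f -> inI (x * f).
Proof. by move=> [y [z ->]]; exists (x * y), (x * z); ring. Qed.

Lemma inI_proj c f : inI f -> inI (pr c f).
Proof.
move=> [x [y ->]]; exists (pr c x), (pr c y).
have := proj_lin sc_iota (s * s') zeta c 1 (A ^+ n * x) (B ^+ t * y).
rewrite rmorph1 !mul1r => ->.
have := proj_mul zetaN c x (hom_A n); rewrite add0n => ->.
by have := proj_mul zetaN c y (hom_B t); rewrite add0n => ->.
Qed.

(** [A] and [B] involve only [N]-th powers of the variables and [q^N = 1], so [X] commutes with
    multiplication by them. *)
Lemma inI_iterX m f : inI f -> inI (iter m X f).
Proof.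
move=> If; elim: m => //= m [x [y ->]].
have qN : q ^+ (s * s') = 1 by rewrite exprM (prim_expr_order qs) expr1n.
exists (X x), (X y); rewrite /Xop rmorphD !rmorphM sc_A ?expr1n // sc_B //; ring.
Qed.

Lemma iterX_S e f : iter (s * e) X f = S ^+ e * f.
Proof.
elim: e f => [|e IH] f; first by rewrite muln0 mul1r.
by rewrite mulnS iterD IH (iterX_prim sc_iota sc_u sc_v uv_span) // exprS mulrA.
Qed.

Lemma iterX_SM m e f : iter m X (S ^+ e * f) = S ^+ e * iter m X f.
Proof. by rewrite -!iterX_S -!iterD addnC. Qed.

Lemma iterX_u m r f : iter m X (u ^+ r * f) = u ^+ r * iter m X f.
Proof.
elim: r => [|r IH]; first by rewrite !mul1r.
rewrite exprS -!mulrA -IH; elim: m {IH} => //= m ->.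
by rewrite Xop_u.
Qed.

Lemma hom_S e : hom (s * e) (S ^+ e).
Proof.
elim: e => [|e IH]; first by move=> z _; rewrite muln0 !rmorph1 mulr1.
rewrite mulnS exprS; apply: homogcM IH.
apply: (homogc_lin sc_iota); [exact: homogc_u | exact: homogc_v].
Qed.

Lemma proj_S e c f : pr (s * e + c) (S ^+ e * f) = S ^+ e * pr c f.
Proof. by rewrite (proj_mul zetaN c f (hom_S e)). Qed.

Lemma proj_modM c m f : pr (c + s * s' * m) f = pr c f.
Proof.
elim: m => [|m IH]; first by rewrite muln0 addn0.
by rewrite mulnS addnCA addnC proj_modn.
Qed.

Variable p : nat -> {poly k}.
Hypothesis pP : forall j, (j < n)%N -> (j < t)%N ->
  [/\ (size (p j) <= j.+1)%N, (p j).[-1] != 0 &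
   forall i, (i < n)%N -> (n <= i + j)%N -> (('X + 1) ^+ (n + t - 1 - 2 * j) * p j)`_i = 0].

Local Notation d j := (n + t - 1 - 2 * j)%N.
Local Notation F := (iota (la ^+ s) * (U - iota theta)).
Local Notation H z := (W - iota z).
Local Notation c0 z := (la ^+ s * theta + z).

(** The form [p_j(F, H)] on the component of [(theta, z)], which the powers of [geom] isolate modulo
    the relations. The scalar in [F] is there so that [F + H = S - c0(z)]. *)
Definition hwv (z : k) (j : nat) : C :=
  geom U (iota theta) ^+ n * geom W (iota z) ^+ t * homog iota (p j) j F (H z).

(** The last [N - r] applications of [X] move degree [r] to [0] modulo [N], so that the generator
    has weight exactly [sigma lam]. If [c0 z = 0], [S] is nilpotent on the component and such a
    shift would lose vectors, so [gen0] keeps its own degree. *)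
Definition gen1 z r j : C := iter (s * s' - r) X (u ^+ r * pr 0%N (hwv z j)).
Definition gen0 z r c j : C := u ^+ r * pr (s * c)%N (hwv z j).

Lemma geomF m : geom U (iota theta) ^+ m * F ^+ m = iota (la ^+ s) ^+ m * A ^+ m.
Proof.
rewrite exprMn mulrCA -exprMn [_ * (U - _)]mulrC geomM.
by rewrite [iota (theta ^+ s')]rmorphXn exprM.
Qed.

Lemma geomH z m : z ^+ s' = eta ^+ s' -> geom W (iota z) ^+ m * H z ^+ m = B ^+ m.
Proof. by move=> zE; rewrite -exprMn mulrC geomM -exprM -zE rmorphXn. Qed.

Lemma FH z : F + H z = S - iota (c0 z).
Proof. by rewrite rmorphD rmorphM; ring. Qed.

(** On the component, [F^n] and [H^t] vanish: with the powers of [geom] they complete to multiples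
    of [A^n] and [B^t]. *)
Lemma geom_inI z a b f : z ^+ s' = eta ^+ s' -> (n <= a)%N || (t <= b)%N ->
  inI (geom U (iota theta) ^+ n * geom W (iota z) ^+ t * (F ^+ a * H z ^+ b) * f).
Proof.
move=> zE /orP [] h; rewrite -(subnK h) exprD.
  exists (iota (la ^+ s) ^+ n * (geom W (iota z) ^+ t * (F ^+ (a - n) * H z ^+ b) * f)), 0.
  rewrite mulr0 addr0 [RHS]mulrCA [RHS]mulrA -geomF.
  by move: (geom U _ ^+ n) (geom W _ ^+ t) (F ^+ n) (F ^+ _) (H z ^+ _) => x1 x2 x3 x4 x5; ring.
exists 0, (geom U (iota theta) ^+ n * (F ^+ a * H z ^+ (b - t)) * f).
rewrite mulr0 add0r -(geomH t zE).
by move: (geom U _ ^+ n) (geom W _ ^+ t) (H z ^+ t) (F ^+ _) (H z ^+ _) => x1 x2 x3 x4 x5; ring.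
Qed.

Lemma inI_D f g : inI f -> inI g -> inI (f + g).
Proof. by move=> [x [y ->]] [x' [y' ->]]; exists (x + x'), (y + y'); ring. Qed.

Lemma hwv_ann z j : z ^+ s' = eta ^+ s' -> (j < n)%N -> (j < t)%N ->
  inI ((S - iota (c0 z)) ^+ (d j) * hwv z j).
Proof.
move=> zE jn jt; have [sp _ van] := pP jn jt.
have [x [y h]] := homog_annihilated iota F (H z) jn jt sp van.
rewrite /hwv mulrCA -FH h mulrDr; apply: inI_D.
  have := geom_inI (a := n) (b := 0) x zE; rewrite leqnn => /(_ isT).
  by congr inI; ring.
have := geom_inI (a := 0) (b := t) y zE; rewrite leqnn orbT => /(_ isT).
by congr inI; ring.
Qed.

Lemma gen1_hom z r j : (r < s)%N -> hom 0 (gen1 z r j).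
Proof.
move=> rs; rewrite -homogc_mod add0n.
have rN : (r <= s * s')%N by apply: (leq_trans (ltnW rs)); rewrite leq_pmulr.
rewrite -{2}(subnK rN); apply: (homogc_iterX sc_iota sc_u sc_v uv_span).
by rewrite -[r in hom r _]addn0; apply: homogcM; [exact: homogc_u | exact: proj_homogc].
Qed.

Lemma gen0_hom z r c j : hom (r + s * c) (gen0 z r c j).
Proof. by apply: homogcM; [exact: homogc_u | exact: proj_homogc]. Qed.

(** [S^s'] has degree [s s'], which is [0] modulo the period of the grading. *)
Lemma proj_ev c g f : pr c (ev (S ^+ s') g * f) = ev (S ^+ s') g * pr c f.
Proof.
rewrite !ev_poly !mulr_suml.
elim/big_rec2: _ => [|i y1 y2 _ <-]; first exact: proj0.
rewrite -mulrA (proj_lin sc_iota) -!mulrA; congr (_ * _ + _).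
rewrite -!exprM; have := proj_modM c i; have := proj_S (s' * i) c f.
by rewrite mulnA addnC => <- ->.
Qed.

Lemma iterX_ev m g f : iter m X (ev (S ^+ s') g * f) = ev (S ^+ s') g * iter m X f.
Proof.
rewrite !ev_poly !mulr_suml.
elim/big_rec2: _ => [|i y1 y2 _ <-]; first by rewrite iterX0.
rewrite -mulrA (iterX_lin _ _ sc_iota) -!mulrA; congr (_ * _ + _).
by rewrite -!exprM iterX_SM.
Qed.

(** [S^s' - c0^s'] is a multiple of [S - c0], whose power [d j] kills [hwv z j]; polynomials in
    [S^s'] commute with [X] and with the projections. *)
Lemma gen1_ann z r j : z ^+ s' = eta ^+ s' -> (j < n)%N -> (j < t)%N ->
  inI ((S ^+ s' - iota (c0 z ^+ s')) ^+ (d j) * gen1 z r j).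
Proof.
move=> zE jn jt.
have -> : (S ^+ s' - iota (c0 z ^+ s')) ^+ (d j)
   = ev (S ^+ s') (('X - (c0 z ^+ s')%:P) ^+ (d j)).
  by rewrite ev_XsubC.
rewrite -iterX_ev; apply: inI_iterX.
rewrite mulrCA -proj_ev; apply: inI_M; apply: inI_proj.
rewrite ev_XsubC [iota (_ ^+ s')]rmorphXn -geomM exprMn.
rewrite [_ ^+ d j * geom _ _ ^+ _]mulrC -mulrA; apply: inI_M.
exact: hwv_ann.
Qed.

Lemma gen0_ann z r c j : z ^+ s' = eta ^+ s' -> (j < n)%N -> (j < t)%N -> c0 z = 0 ->
  inI (iter (s * d j) X (gen0 z r c j)).
Proof.
move=> zE jn jt z0; rewrite iterX_S mulrCA -proj_S; apply: inI_M; apply: inI_proj.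
by have := hwv_ann zE jn jt; rewrite z0 rmorph0 subr0.
Qed.

(** * The generators span modulo the relations *)

Section Span.
Variable L : C -> Prop.
Hypothesis sL : subspace iota L.
Hypothesis LX : forall f, L f -> L (X f).
Hypothesis LI : forall f, inI f -> L f.
Hypothesis Lgen : forall z, z ^+ s' = eta ^+ s' -> forall r j, (r < s)%N -> (j < n)%N -> (j < t)%N ->
  if c0 z == 0 then forall c, (c < s')%N -> L (gen0 z r c j) else L (gen1 z r j).

Lemma L_iterX m f : L f -> L (iter m X f).
Proof. by move=> Lf; elim: m => //= m; apply: LX. Qed.

(** For [c0 z != 0] the orbit of [gen1] under [X] contains [u^r pr (s e) (S^e hwv)] for [e >= s'].
    As [S] is [c0] plus a nilpotent on [hwv], combinations of [S^e] with [e] congruent to [c] modulo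
    [s'] already give [1]. *)
Lemma L_gen0 z r c j : z ^+ s' = eta ^+ s' -> (r < s)%N -> (j < n)%N -> (j < t)%N ->
  L (gen0 z r c j).
Proof.
move=> zE rs jn jt; have := Lgen zE rs jn jt.
case: (eqVneq (c0 z) 0) => [_ Lg|z0 Lg].
  have := Lg (c %% s')%N; rewrite ltn_mod s'0 => /(_ isT).
  have := proj_modM (s * (c %% s')) (c %/ s') (hwv z j).
  rewrite -mulnA -mulnDr [(_ + s' * _)%N]addnC [(s' * _)%N]mulnC -divn_eq.
  by rewrite /gen0 => ->.
have L1 e : (s' <= e)%N -> L (u ^+ r * pr (s * e) (S ^+ e * hwv z j)).
  move=> es; rewrite -[(s * e)%N]addn0 proj_S mulrCA -iterX_S.
  have -> : (s * e = (s * e - (s * s' - r)) + (s * s' - r))%N by rewrite subnK //; nia.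
  by rewrite iterD; apply: L_iterX.
pose L' (g : {poly k}) := L (u ^+ r * pr (s * c) (ev S g * hwv z j)).
suff: L' 1 by rewrite /L' rmorph1 mul1r.
have sL' : subspace (@polyC k : {rmorphism k -> {poly k}}) L'.
  split=> [|a f g Lf Lg']; rewrite /L'.
    by rewrite rmorph0 mul0r proj0 mulr0; apply: sL.1.
  rewrite rmorphD rmorphM /= evC mulrDl -mulrA (proj_lin sc_iota) mulrDr mulrCA.
  exact: sL.2.
apply: (adic_span (c0 := c0 z) (d := d j) sL') => [f|i].
  apply: LI; apply: inI_M; apply: inI_proj.
  rewrite rmorphM /= ev_XsubC [_ * ev S f]mulrC -mulrA.
  by apply: inI_M; apply: hwv_ann.
(* The cofactor turns [(X - c0)^i] into a polynomial in [X^s'], so only exponents at least [s'] and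
   congruent to [c] modulo [s'] occur; its value at [c0] is nonzero. *)
exists (geomp s' (c0 z) ^+ i * 'X^(c + s')).
  rewrite hornerM !horner_exp geomp_diag hornerX mulf_eq0 !expf_eq0 (negbTE z0) !andbF orbF.
  by rewrite mulf_eq0 expf_eq0 (negbTE z0) andbF orbF (negbTE (natr_neq0 k_char0 s'0)) andbF.
have -> : ('X - (c0 z)%:P) ^+ i * (geomp s' (c0 z) ^+ i * 'X^(c + s')) =
   ((('X - (c0 z ^+ s')%:P) ^+ i) \Po 'X^s') * 'X^(c + s').
  by rewrite mulrA -exprMn geompM [_ \Po _]rmorphXn /= comp_polyB comp_polyX comp_polyC.
rewrite comp_polyE mulr_suml; apply: (sub_sum sL') => m _.
rewrite -mul_polyC -mulrA; apply: (sub_scale sL').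
rewrite /L' -exprM -exprD evXn.
have := proj_modM (s * c) m.+1 (S ^+ (s' * m + (c + s')) * hwv z j) => <-.
have -> : (s * c + s * s' * m.+1 = s * (s' * m + (c + s')))%N by nia.
by apply: L1; nia.
Qed.

(** The Lefschetz argument, applied to the [f] all of whose projections land in [L]. Quantifying
    over [c] makes this subspace stable under [S], which acts as [X^s] and shifts [c]. *)
Lemma L_component z r c a b : z ^+ s' = eta ^+ s' -> (r < s)%N ->
  L (u ^+ r * pr (s * c) (geom U (iota theta) ^+ n * geom W (iota z) ^+ t * (F ^+ a * H z ^+ b))).
Proof.
move=> zE rs.
pose G := geom U (iota theta) ^+ n * geom W (iota z) ^+ t.
pose L' f := forall c, L (u ^+ r * pr (s * c) (G * f)).
suff: L' (F ^+ a * H z ^+ b) by apply.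
have sL' : subspace iota L'.
  split=> [|x f g Lf Lg'] {}c.
    by rewrite mulr0 proj0 mulr0; apply: sL.1.
  rewrite mulrDr mulrCA (proj_lin sc_iota) mulrDr mulrCA.
  by apply: sL.2; [apply: Lf | apply: Lg'].
apply: (lefschetz_span (n := n) (t := t) (p := p) sL') => [x Lx e||].
- rewrite FH mulrBl; apply: (sub_sub sL'); last exact: (sub_scale sL').
  move=> {}e; have := proj_modM (s * e) 1 (G * (S * x)); rewrite muln1.
  (* [e + s' - 1] stands for [e - 1] modulo [s']. *)
  have -> : (s * e + s * s' = s * 1 + s * (e + s'.-1))%N by nia.
  rewrite [G * _]mulrCA -{1}[S]expr1 proj_S mulrCA -iterX_S => <-.
  by rewrite -iterX_u; apply: L_iterX; apply: Lx.
- move=> a' b' ab e; apply: LI; apply: inI_M; apply: inI_proj.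
  by have := geom_inI 1 zE ab; rewrite mulr1.
- move=> j jn jt; have [sp p1 _] := pP jn jt; split => // e.
  by have := L_gen0 e zE rs jn jt.
Qed.

(** The components for all [z] are glued in [k[W]]: the admissible [h] form an ideal containing
    [(W^s' - beta)^t] and, for each root [z], the power [geomp s' z ^+ t], which is nonzero at
    [z]. *)
Lemma L_theta r c g : (r < s)%N ->
  L (u ^+ r * pr (s * c) (geom U (iota theta) ^+ n * ev U g)).
Proof.
move=> rs; set G := geom _ _ ^+ n.
have sLp a : subspace iota (fun f => L (u ^+ r * pr (s * c) (a * f))).
  split=> [|x f f' Lf Lg'].
    by rewrite mulr0 proj0 mulr0; apply: sL.1.
  rewrite mulrDr mulrCA (proj_lin sc_iota) mulrDr mulrCA.
  exact: sL.2.
pose J h := forall g g', L (u ^+ r * pr (s * c) (G * (ev U g * ev W (g' * h)))).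
suff: J 1 by move=> /(_ g 1); rewrite mulr1 rmorph1 mulr1.
have JB : J (('X^s' - (eta ^+ s')%:P) ^+ t).
  move=> x y; apply: LI; apply: inI_M; apply: inI_proj; rewrite rmorphM mulrA; apply: inI_M.
  apply: inI_M; exists 0, 1; rewrite mulr0 add0r mulr1 ev_XnsubC.
  by rewrite -exprM.
apply: (ideal_without_roots (J := J)).
- move=> h h' Jh Jh' x y; rewrite mulrDr rmorphD mulrDr.
  by apply: (sub_add (sLp G)); [apply: Jh | apply: Jh'].
- by move=> h h' Jh x y; rewrite [y * _]mulrA; apply: Jh.
- exists (('X^s' - (eta ^+ s')%:P) ^+ t); last exact: JB.
  by rewrite expf_eq0 (negbTE (monic_neq0 (monicXnsubC _ s'0))) andbF.
move=> z; case: (eqVneq (z ^+ s') (eta ^+ s')) => [zE|zE]; last first.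
  exists (('X^s' - (eta ^+ s')%:P) ^+ t); first exact: JB.
  by rewrite horner_exp !hornerE expf_eq0 subr_eq0 (negbTE zE) andbF.
have z0 : z != 0.
  apply: contra_neq eta0 => z0; move/eqP: zE.
  by rewrite z0 expr0n gtn_eqF // eq_sym expf_eq0 s'0 => /eqP.
exists (geomp s' z ^+ t); last first.
  rewrite horner_exp geomp_diag expf_eq0 mulf_eq0 (negbTE (natr_neq0 k_char0 s'0)).
  by rewrite expf_eq0 (negbTE z0) !andbF.
move=> x y.
apply: (ev_affine (L := fun f => L (u ^+ r * pr (s * c) (G * f))) (a := la ^+ s) (z := theta)).
- exact: sLp.
- by rewrite expf_neq0.
move=> a; cbv beta; rewrite rmorphM [ev W (geomp _ _ ^+ t)]rmorphXn ev_geomp [_ ^+ a * _]mulrCA.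
apply: (ev_affine (L := fun f => L (u ^+ r * pr (s * c) (G * f))) (a := 1) (z := z)).
- exact: sLp.
- exact: oner_neq0.
move=> b; cbv beta; rewrite rmorph1 mul1r.
have := L_component c a b zE rs.
by congr (L (_ * pr _ _)); rewrite -/G; ring.
Qed.

(** Generators near [U = theta] suffice: scaling [u] and [v] by an [N]-th root of unity [x] with
    [x^s = theta / z] carries [theta] to the other root [z], and changes a projection only by a
    scalar. *)
Lemma L_rotate r c g z : z ^+ s' = theta ^+ s' -> (r < s)%N ->
  L (u ^+ r * pr (s * c) (geom U (iota z) ^+ n * ev U g)).
Proof.
move=> zE rs.
have z0 : z != 0.
  apply: contra_neq theta0 => z0; move/eqP: zE.
  by rewrite z0 expr0n gtn_eqF // eq_sym expf_eq0 s'0 => /eqP.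
have ws' : s'.-primitive_root (zeta ^+ s).
  by have := dvdn_prim_root zetaN (dvdn_mull s (dvdnn s')); rewrite mulnK.
have /(prim_rootP ws') [i iE] : (theta / z) ^+ s' = 1.
  by rewrite expr_div_n -zE divff // expf_neq0.
set x := zeta ^+ i.
have xN : x ^+ (s * s') = 1 by rewrite exprAC (prim_expr_order zetaN) expr1n.
have x0 : x != 0 by rewrite expf_neq0 // (prim_root_neq0 zetaN).
have scU : sc x x U = iota (x ^+ s) * U by rewrite rmorphXn sc_u exprMn -rmorphXn.
have scE f : sc x x (ev U f) = ev U (f \Po (x ^+ s *: 'X)).
  rewrite ev_comp -mul_polyC rmorphM evC evX -scU !ev_poly rmorph_sum.
  by apply: eq_bigr => m _; rewrite rmorphM sc_iota rmorphXn.
have thE : theta = x ^+ s * z by rewrite /x exprAC -iE divfK.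
have := L_theta c (g \Po (x ^- s *: 'X)) rs.
have := proj_sc sc_iota sc_u sc_v uv_span zetaN (s * c)
  (geom U (iota theta) ^+ n * ev U (g \Po (x ^- s *: 'X))) xN.
set f1 := ev U _; rewrite rmorphM rmorphXn {1}/f1 scE -comp_polyA comp_polyZ comp_polyX scalerA.
rewrite mulVf; last exact: expf_neq0.
rewrite scale1r comp_polyXr.
have -> : sc x x (geom U (iota theta)) = iota (x ^+ s) ^+ s'.-1 * geom U (iota z).
  rewrite -geom_scale rmorph_sum; apply: eq_bigr => m _.
  by rewrite rmorphM [sc x x (U ^+ _)]rmorphXn scU [sc x x (_ ^+ m)]rmorphXn sc_iota thE rmorphM.
rewrite exprMn -exprM -rmorphXn -mulrA => prE /(sub_scale sL (x ^+ (s * c))).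
rewrite mulrCA -prE.
have := proj_lin sc_iota (s * s') zeta (s * c) ((x ^+ s) ^+ (s'.-1 * n)) (geom U (iota z) ^+ n * ev U g) 0.
rewrite proj0 !addr0 => ->.
by rewrite mulrCA => /(sub_scaleI sL); apply; apply/expf_neq0/expf_neq0.
Qed.

(** The components in [U] are glued as those in [W] were; then [pr] is applied to [U^c], which it
    multiplies by the nonzero scalar [s s']. *)
Lemma L_u r c : (r < s)%N -> L (u ^+ (r + s * c)).
Proof.
move=> rs.
have sL' : subspace iota (fun f => L (u ^+ r * pr (s * c) f)).
  split=> [|x f f' Lf Lg'].
    by rewrite proj0 mulr0; apply: sL.1.
  rewrite (proj_lin sc_iota) mulrDr mulrCA.
  exact: sL.2.
pose J h := forall g, L (u ^+ r * pr (s * c) (ev U (g * h))).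
suff: J 1.
  have hu : hom (s * c) (u ^+ (s * c)) by apply: homogc_u.
  move=> /(_ 'X^c); rewrite mulr1 evXn -exprM (proj_id zetaN hu).
  rewrite mulrCA -exprD -(rmorph_nat iota) => /(sub_scaleI sL).
  by apply; apply: natr_neq0 N0.
have JA : J (('X^s' - (theta ^+ s')%:P) ^+ n).
  move=> x; apply: LI; apply: inI_M; apply: inI_proj; rewrite rmorphM; apply: inI_M.
  by exists 1, 0; rewrite mulr0 addr0 mulr1 ev_XnsubC -exprM.
apply: (ideal_without_roots (J := J)).
- move=> h h' Jh Jh' x; rewrite mulrDr rmorphD.
  by apply: (sub_add sL'); [apply: Jh | apply: Jh'].
- by move=> h h' Jh x; rewrite [x * _]mulrA; apply: Jh.
- exists (('X^s' - (theta ^+ s')%:P) ^+ n); last exact: JA.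
  by rewrite expf_eq0 (negbTE (monic_neq0 (monicXnsubC _ s'0))) andbF.
move=> z; case: (eqVneq (z ^+ s') (theta ^+ s')) => [zE|zE]; last first.
  exists (('X^s' - (theta ^+ s')%:P) ^+ n); first exact: JA.
  by rewrite horner_exp !hornerE expf_eq0 subr_eq0 (negbTE zE) andbF.
have z0 : z != 0.
  apply: contra_neq theta0 => z0; move/eqP: zE.
  by rewrite z0 expr0n gtn_eqF // eq_sym expf_eq0 s'0 => /eqP.
exists (geomp s' z ^+ n); last first.
  rewrite horner_exp geomp_diag expf_eq0 mulf_eq0 (negbTE (natr_neq0 k_char0 s'0)).
  by rewrite expf_eq0 (negbTE z0) !andbF.
by move=> g; rewrite [g * _]mulrC rmorphM [ev U (_ ^+ n)]rmorphXn ev_geomp; apply: L_rotate.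
Qed.

(** Powers of [u] suffice, since [X] raises the exponent of [v] by one up to a term with the old
    exponent. *)
Lemma gens_span f : L f.
Proof.
apply: (uv_span sL) => i j; elim: j i => [|j IH] i.
  rewrite mulr1 (divn_eq i s) addnC mulnC; apply: L_u; exact: ltn_pmod.
have -> : u ^+ i * v ^+ j.+1 = X (u ^+ i * v ^+ j) - iota (la * q ^+ j) * (u ^+ i.+1 * v ^+ j).
  rewrite /Xop !(rmorphM, rmorphXn) sc_u sc_v rmorph1 mul1r /= exprMn !exprS; ring.
by apply: (sub_sub sL); [apply: LX | apply: (sub_scale sL)].
Qed.

End Span.
End Components.

(** * Morphisms of modules in matrix form *)

Lemma sum_dvdn (V : nmodType) (f : nat -> V) d m : (0 < d)%N ->
  \sum_(l < m * d) (if (d %| l)%N then f l else 0) = \sum_(i < m) f (i * d)%N.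
Proof.
move=> d0; elim: m => [|m IH]; first by rewrite mul0n !big_ord0.
rewrite mulSn addnC big_split_ord /= IH big_ord_recr /=; congr (_ + _).
rewrite -(prednK d0) big_ord_recl /= addn0 big1 ?addr0 => [|l _].
  by rewrite prednK // dvdn_mull.
rewrite prednK // dvdn_addr ?dvdn_mull // gtnNdvd //.
by rewrite /bump /= -ltn_predRL.
Qed.

Section HmodMorphisms.
Variables (k : fieldType) (G : groupType).
Implicit Types (M V T : hmod k G).

(** A morphism of modules [V -> T] whose image contains [gens]. In this form covers add up over
    direct sums, and injectivity is left to a dimension count. *)
Definition hcover V T (gens : 'cV[k]_(hdim T) -> Prop) : Prop :=
  exists P : 'M[k]_(hdim T, hdim V),
    [/\ (forall g, P *m hrho V g = hrho T g *m P), P *m hx V = hx T *m P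
      & forall w, gens w -> exists c, w = P *m c].

Lemma hcover_zero T : hcover (hzero k G) (fun _ : 'cV[k]_(hdim T) => False).
Proof.
exists 0; split => // [g|]; last by rewrite mul0mx mulmx0.
by rewrite mul0mx mulmx0.
Qed.

Lemma hcover_dsum V V' T gens gens' :
  @hcover V T gens -> @hcover V' T gens' ->
  @hcover (hdsum V V') T (fun w => gens w \/ gens' w).
Proof.
move=> [P [Pg Px Pw]] [P' [Pg' Px' Pw']]; exists (row_mx P P'); split=> [g||w []].
- by rewrite mul_row_block !mulmx0 addr0 add0r Pg Pg' mul_mx_row.
- by rewrite mul_row_block !mulmx0 addr0 add0r Px Px' mul_mx_row.
- by move=> /Pw [c ->]; exists (col_mx c 0); rewrite mul_row_col mulmx0 addr0.
- by move=> /Pw' [c ->]; exists (col_mx 0 c); rewrite mul_row_col mulmx0 add0r.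
Qed.

Lemma hcover_sub V T (gens gens' : 'cV[k]_(hdim T) -> Prop) :
  (forall w, gens' w -> gens w) -> hcover V gens -> hcover V gens'.
Proof. by move=> h [P [Pg Px Pw]]; exists P; split => // w /h; apply: Pw. Qed.

Lemma hcover_map (I : eqType) (r : seq I) (f : I -> hmod k G) T
    (gens : I -> 'cV[k]_(hdim T) -> Prop) :
  (forall i, i \in r -> hcover (f i) (gens i)) ->
  hcover (hbigsum [seq f i | i <- r]) (fun w => exists2 i, i \in r & gens i w).
Proof.
elim: r => [|i r IH] h /=; first by apply: hcover_sub (hcover_zero T) => w [].
have hr : hcover (hbigsum [seq f i | i <- r]) (fun w => exists2 i, i \in r & gens i w).
  by apply: IH => j jr; apply: h; rewrite in_cons jr orbT.
apply: hcover_sub (hcover_dsum (h i (mem_head i r)) hr) => w [j].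
rewrite in_cons => /orP [/eqP ->|jr] gw; first by left.
by right; exists j.
Qed.

Lemma hdim_hbigsum (r : seq (hmod k G)) : hdim (hbigsum r) = \sum_(V <- r) hdim V.
Proof. by elim: r => [|V r IH]; rewrite ?big_nil // big_cons /= IH. Qed.

(** The image is a subspace stable under [x] and containing [gens], so it is [T] by the last
    hypothesis, an induction principle. A surjection between equal dimensions is invertible. *)
Lemma hcover_iso V T (gens : 'cV[k]_(hdim T) -> Prop) :
  hdim V = hdim T -> hcover V gens ->
  (forall L : 'cV[k]_(hdim T) -> Prop, L 0 ->
     (forall c w w', L w -> L w' -> L (c *: w + w')) ->
     (forall w, L w -> L (hx T *m w)) ->
     (forall w, gens w -> L w) -> forall w, L w) ->
  hiso T V.
Proof.
move=> dVT [P [Pg Px Pw]] full.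
have imP (w : 'cV[k]_(hdim T)) : exists c, w = P *m c.
  move: w; apply: (full (fun w => exists c, w = P *m c)).
  - by exists 0; rewrite mulmx0.
  - by move=> a w w' [c ->] [c' ->]; exists (a *: c + c'); rewrite mulmxDr scalemxAr.
  - by move=> w [c ->]; exists (hx V *m c); rewrite !mulmxA Px.
  - exact: Pw.
have fullP : row_full P^T.
  rewrite -sub1mx; apply/row_subP => i; have [c cE] := imP (row i 1%:M)^T.
  by rewrite -[row i _]trmxK cE trmx_mul; apply: submxMl.
have rP : row_free P.
  by rewrite /row_free -mxrank_tr; exact: fullP.
have [Q PQ] := row_freeP rP.
have QP : Q *m P = 1%:M.
  move: P Q PQ {Pg Px Pw imP fullP rP}; rewrite dVT => P Q; exact: mulmx1C.
exists Q, P; split => // [g|].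
  by rewrite -[Q *m _]mulmx1 -PQ -mulmxA (mulmxA _ P) -Pg !mulmxA QP mul1mx.
by rewrite -[Q *m _]mulmx1 -PQ -mulmxA (mulmxA _ P) -Px !mulmxA QP mul1mx.
Qed.

Definition colmx d m (f : nat -> 'cV[k]_d) : 'M[k]_(d, m) := \matrix_(i, j) f j i 0.

Lemma mul_colmx d d' m (f : nat -> 'cV[k]_d) (B : 'M[k]_(d', d)) :
  B *m colmx m f = colmx m (fun j => B *m f j).
Proof. by apply/matrixP => i j; rewrite !mxE; apply: eq_bigr => l _; rewrite mxE. Qed.

Lemma colmx_mul d m (f : nat -> 'cV[k]_d) (c : 'M[k]_m) :
  colmx m f *m c = \matrix_(i, j) (\sum_(l < m) c l j *: f l) i 0.
Proof.
apply/matrixP => i j; rewrite !mxE summxE; apply: eq_bigr => l _.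
by rewrite !mxE mulrC.
Qed.

Lemma colmx_diag d m (f : nat -> 'cV[k]_d) (c : nat -> k) :
  colmx m f *m \matrix_(i, j) ((i == j)%:R * c i) = colmx m (fun j => c j *: f j).
Proof.
rewrite colmx_mul; apply/matrixP => i j; rewrite !mxE.
rewrite (bigD1 j) //= big1 ?addr0 => [|l lj]; first by rewrite !mxE eqxx mul1r.
by rewrite mxE (negbTE lj) mul0r scale0r.
Qed.

Lemma colmx_ext d m (f f' : nat -> 'cV[k]_d) :
  (forall j, (j < m)%N -> f j = f' j) -> colmx m f = colmx m f'.
Proof. by move=> ff'; apply/matrixP => i j; rewrite !mxE ff'. Qed.

Lemma colmx0 d m (f : nat -> 'cV[k]_d) : (0 < m)%N -> exists c, f 0%N = colmx m f *m c.
Proof.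
move=> m0; exists (delta_mx (Ordinal m0) 0); rewrite -colE.
by apply/colP => i; rewrite !mxE.
Qed.

(** * Morphisms out of [V_m(mu)] and [V_m(mu, gamma)] defined by a weight vector *)

Section WeightVectors.
Variables (chi mu : G -> k) (T : hmod k G) (w : 'cV[k]_(hdim T)).
Hypothesis Tx : forall g, hrho T g *m hx T = chi g *: (hx T *m hrho T g).
Hypothesis wmu : forall g, hrho T g *m w = mu g *: w.

Local Notation xw m := (iter m (mulmx (hx T)) w).

Lemma iter_weight g m : hrho T g *m xw m = (chi g ^+ m * mu g) *: xw m.
Proof.
elim: m => [|m IH] /=; first by rewrite mul1r.
by rewrite mulmxA Tx -scalemxAl -mulmxA IH -scalemxAr scalerA exprS mulrA.
Qed.

Lemma hcover_Vmod m : (0 < m)%N -> xw m = 0 -> hcover (Vmod chi mu m) (eq w).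
Proof.
move=> m0 xm; exists (colmx m (fun j => xw j)); split=> [g||_ <-].
- rewrite mul_colmx; have D := @colmx_diag (hdim T) m (fun j => xw j) (fun i => chi g ^+ i * mu g).
  rewrite [LHS]D; apply: colmx_ext => j _.
  by rewrite iter_weight.
- rewrite mul_colmx colmx_mul; apply/matrixP => i j; rewrite mxE [RHS]mxE; congr (fun_of_matrix _ i 0).
  rewrite -[hx T *m _]/(xw j.+1); case: (ltnP j.+1 m) => jm.
    rewrite (bigD1 (Ordinal jm)) //= big1 ?addr0 => [|l]; first by rewrite mxE eqxx scale1r.
    by rewrite -val_eqE mxE /= => /negbTE ->; rewrite scale0r.
  have jE : j.+1 = m by apply/eqP; rewrite eqn_leq jm ltn_ord.
  by rewrite jE xm big1 // => l _; rewrite mxE jE ltn_eqF ?scale0r.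
- exact: (colmx0 (fun j => xw j)).
Qed.

(** The basis vector [m_j] goes to [x^j w]. The hypothesis is [(x^sbar - gamma)^m w = 0]; solved for
    its leading term it is the last column of the action of [x]. *)
Lemma hcover_Vmod2 sbar gamma m : (0 < sbar)%N -> (0 < m)%N ->
  \sum_(i < m.+1) (('X - gamma%:P) ^+ m)`_i *: xw (sbar * i) = 0 ->
  hcover (Vmod2 chi mu sbar gamma m) (eq w).
Proof.
move=> sb0 m0 xm; have ms0 : (0 < m * sbar)%N by rewrite muln_gt0 m0.
exists (colmx (m * sbar) (fun j => xw j)); split=> [g||_ <-].
- rewrite mul_colmx; have D := @colmx_diag (hdim T) (m * sbar) (fun j => xw j) (fun i => chi g ^+ i * mu g).
  rewrite [LHS]D; apply: colmx_ext => j _.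
  by rewrite iter_weight.
- rewrite mul_colmx colmx_mul; apply/matrixP => i j; rewrite mxE [RHS]mxE; congr (fun_of_matrix _ i 0).
  rewrite -[hx T *m _]/(xw j.+1); case: (ltnP j.+1 (m * sbar)) => jm.
    rewrite (bigD1 (Ordinal jm)) //= big1 ?addr0 => [|l]; first by rewrite mxE jm eqxx scale1r.
    by rewrite -val_eqE mxE /= jm => /negbTE ->; rewrite scale0r.
  have jE : j.+1 = (m * sbar)%N by apply/eqP; rewrite eqn_leq jm ltn_ord.
  rewrite jE.
  have lead : (('X - gamma%:P) ^+ m)`_m = 1.
    have := monicP (monic_exp m (monicXsubC gamma)).
    by rewrite lead_coefE size_exp_XsubC.
  move: xm; rewrite big_ord_recr /= lead scale1r => /eqP.
  rewrite addrC addr_eq0 mulnC => /eqP ->; rewrite -sumrN.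
  transitivity (\sum_(l < m * sbar)
      if (sbar %| l)%N then Valpha gamma m (l %/ sbar) *: xw l else 0).
    by apply: eq_bigr => l _; rewrite mxE jE ltnn; case: ifP => // _; exact: scale0r.
  rewrite (sum_dvdn (fun l => Valpha gamma m (l %/ sbar) *: xw l)) //.
  by apply: eq_bigr => l _; rewrite mulnK // /Valpha scaleNr mulnC.
- exact: (colmx0 (fun j => xw j)).
Qed.

End WeightVectors.

End HmodMorphisms.

(** * The ring [k[u, v]] as iterated polynomials *)

Section BivariateModel.
Variable k : fieldType.
Local Notation C := {poly {poly k}}.

(** [u] is the inner variable ['X%:P] and [v] the outer variable ['X]. *)
Definition cst : {rmorphism k -> C} := (@polyC {poly k} \o @polyC k).
Definition scale2 (x y : k) : {rmorphism C -> C} :=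
  comp_poly (y%:P *: 'X) \o map_poly (comp_poly (x *: 'X)).

Lemma scale2_cst x y c : scale2 x y (cst c) = cst c.
Proof. by rewrite /= /scale2 /= map_polyC /= !comp_polyC. Qed.

Lemma scale2_u x y : scale2 x y 'X%:P = cst x * 'X%:P.
Proof. by rewrite /= map_polyC /= comp_polyC comp_polyX /cst /= -polyCM mul_polyC. Qed.

Lemma scale2_v x y : scale2 x y 'X = cst y * 'X.
Proof. by rewrite /= map_polyX comp_polyX -mul_polyC. Qed.

Lemma bivariate_span (L : C -> Prop) : subspace cst L ->
  (forall i j, L ('X%:P ^+ i * 'X ^+ j)) -> forall f, L f.
Proof.
move=> sL Lm f; rewrite -[f]coefK poly_def; apply: (sub_sum sL) => j _.
rewrite -mul_polyC -[f`_j]coefK poly_def rmorph_sum mulr_suml; apply: (sub_sum sL) => i _.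
by rewrite -mul_polyC rmorphM -mulrA rmorphXn; apply: (sub_scale sL); apply: Lm.
Qed.

Section LinearExtension.
Variables (V : lmodType k).

(** The linear map on [k[X]] with ['X^i] sent to [e i]; [lext2] does the same for monomials in [u]
    and [v]. *)
Definition lext (e : nat -> V) (p : {poly k}) : V := \sum_(i < size p) p`_i *: e i.

Lemma lext_wide e (p : {poly k}) m : (size p <= m)%N -> lext e p = \sum_(i < m) p`_i *: e i.
Proof.
move=> pm; rewrite /lext (big_ord_widen _ (fun i => p`_i *: e i) pm) big_mkcond.
apply: eq_bigr => i _; case: ltnP => // h; by rewrite nth_default // scale0r.
Qed.

Lemma lext_lin e c (p g : {poly k}) : lext e (c *: p + g) = c *: lext e p + lext e g.
Proof.
set m := maxn (size p) (size g).
have s1 : (size (c *: p + g)%R <= m)%N.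
  rewrite (leq_trans (size_polyD _ _)) // geq_max leq_maxr andbT.
  exact: leq_trans (size_scale_leq _ _) (leq_maxl _ _).
rewrite (lext_wide _ s1) (lext_wide _ (leq_maxl _ _ : (size p <= m)%N)).
rewrite (lext_wide _ (leq_maxr _ _ : (size g <= m)%N)) scaler_sumr -big_split.
by apply: eq_bigr => i _; rewrite coefD coefZ scalerDl scalerA.
Qed.

Lemma lext0 e : lext e 0 = 0.
Proof. by rewrite /lext size_poly0 big_ord0. Qed.

Lemma lextXn e i : lext e 'X^i = e i.
Proof.
rewrite (@lext_wide _ _ i.+1) ?size_polyXn // big_ord_recr /= coefXn eqxx scale1r big1 ?add0r // => j _.
by rewrite coefXn ltn_eqF // scale0r.
Qed.

Variable E : nat -> nat -> V.

Definition lext2 (f : C) : V := \sum_(j < size f) lext (E^~ j) f`_j.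

Lemma lext2_wide (f : C) m : (size f <= m)%N -> lext2 f = \sum_(j < m) lext (E^~ j) f`_j.
Proof.
move=> fm; rewrite /lext2 (big_ord_widen _ (fun j => lext (E^~ j) f`_j) fm) big_mkcond.
by apply: eq_bigr => j _; case: ltnP => // h; rewrite nth_default // lext0.
Qed.

Lemma lext2_lin c (f g : C) : lext2 (cst c * f + g) = c *: lext2 f + lext2 g.
Proof.
set m := maxn (size f) (size g).
have s1 : (size (cst c * f + g)%R <= m)%N.
  rewrite (leq_trans (size_polyD _ _)) // geq_max leq_maxr andbT /= mul_polyC.
  exact: leq_trans (size_scale_leq _ _) (leq_maxl _ _).
rewrite (lext2_wide s1) (lext2_wide (leq_maxl _ _ : (size f <= m)%N)).
rewrite (lext2_wide (leq_maxr _ _ : (size g <= m)%N)) scaler_sumr -big_split.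
by apply: eq_bigr => i _; rewrite coefD coefCM mul_polyC lext_lin.
Qed.

Lemma lext2_mono i j : lext2 ('X%:P ^+ i * 'X ^+ j) = E i j.
Proof.
rewrite -rmorphXn /= mul_polyC (@lext2_wide _ j.+1); last first.
  by apply: leq_trans (size_scale_leq _ _) _; rewrite size_polyXn.
rewrite big_ord_recr /= coefZ coefXn eqxx mulr1 lextXn big1 ?add0r // => l _.
by rewrite coefZ coefXn ltn_eqF // mulr0 lext0.
Qed.

Lemma lext2_0 : lext2 0 = 0.
Proof. by rewrite /lext2 size_poly0 big_ord0. Qed.

Lemma linear_ext (V' : lmodType k) (g g' : C -> V') : g 0 = 0 -> g' 0 = 0 ->
  (forall c x y, g (cst c * x + y) = c *: g x + g y) ->
  (forall c x y, g' (cst c * x + y) = c *: g' x + g' y) ->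
  (forall i j, g ('X%:P ^+ i * 'X ^+ j) = g' ('X%:P ^+ i * 'X ^+ j)) -> g =1 g'.
Proof.
move=> g0 g'0 lg lg' gg'; apply: bivariate_span => //.
by split => [|c x y hx hy]; rewrite ?g0 ?g'0 // lg lg' hx hy.
Qed.

End LinearExtension.
End BivariateModel.

(** * [V_m(mu, gamma)] as a cyclic module *)

Section CyclicBasis.
Variables (k : fieldType) (G : groupType) (chi mu : G -> k) (N : nat) (gamma : k) (m : nat).
Hypothesis N0 : (0 < N)%N.
Hypothesis chiN : forall g, chi g ^+ N = 1.
Local Notation V := (Vmod2 chi mu N gamma m).

Lemma Vmod2_comm g : hrho V g *m hx V = chi g *: (hx V *m hrho V g).
Proof.
rewrite scalemxAr; apply/matrixP => i j; rewrite !mxE.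
rewrite (bigD1 i) //= big1 ?addr0 => [|l /negbTE li]; last first.
  by rewrite !mxE eq_sym li !mul0r.
rewrite (bigD1 j) //= big1 ?addr0 => [|l /negbTE lj]; last by rewrite !mxE lj !mul0r !mulr0.
rewrite !mxE !eqxx !mul1r; case: ltnP => jm.
  by case: eqP => [->|_]; rewrite ?mul0r ?mulr0 // exprS; ring.
have jE : j.+1 = (m * N)%N by apply/eqP; rewrite eqn_leq jm ltn_ord.
case: ifP => [/dvdnP [c ->]|_]; last by rewrite mul0r mulr0.
(* In the last column [j + 1 = m N], where the weight returns to [mu] as [chi^N = 1]. *)
have -> : chi g * (chi g ^+ j * mu g) = mu g.
  by rewrite mulrA -exprS jE mulnC exprM chiN expr1n mul1r.
by rewrite mulnC exprM chiN expr1n mul1r mulrC.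
Qed.

Definition vbasis0 : 'cV[k]_(hdim V) := \col_i (i == 0 :> nat)%:R.
(** [x^i m_0] for every [i], also beyond the dimension, so that all monomials of [k[u, v]] have an
    image. *)
Definition vb i : 'cV[k]_(hdim V) := iter i (mulmx (hx V)) vbasis0.

Lemma vb_weight g i : hrho V g *m vb i = (chi g ^+ i * mu g) *: vb i.
Proof.
apply: (iter_weight (chi := chi) (mu := mu)) => {}g; first exact: Vmod2_comm.
apply/colP => l; rewrite !mxE (bigD1 l) //= big1 ?addr0 => [|j /negbTE lj].
  by rewrite !mxE eqxx mul1r; case: eqP => [->|]; rewrite ?mulr0 // mul1r.
by rewrite !mxE eq_sym lj !mul0r.
Qed.

Lemma hx_col j (jm : (j < m * N)%N) :
  hx V *m \col_i (i == j :> nat)%:R = col (Ordinal jm) (hx V).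
Proof.
rewrite colE; congr (_ *m _); apply/colP => i; rewrite !mxE eqxx andbT.
by rewrite -val_eqE.
Qed.

Lemma vb_delta i : (i < m * N)%N -> vb i = \col_l (l == i :> nat)%:R.
Proof.
elim: i => // i IH im; rewrite /vb iterS -/(vb i) IH ?(ltnW im) // (hx_col (ltnW im)).
by apply/colP => l; rewrite !mxE im.
Qed.

(** This is [(x^N - gamma)^m x^i m_0 = 0]: the last column of [x] for [i = 0], then apply [x]. *)
Lemma vb_rel i : (0 < m)%N ->
  \sum_(l < m.+1) (('X - gamma%:P) ^+ m)`_l *: vb (N * l + i) = 0.
Proof.
move=> m0; elim: i => [|i IH]; last first.
  move/(congr1 (mulmx (hx V))): IH; rewrite mulmx0 mulmx_sumr => {2}<-.
  by apply: eq_bigr => l _; rewrite addnS -scalemxAr.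
have ms0 : (0 < m * N)%N by rewrite muln_gt0 m0.
have jm : ((m * N).-1 < m * N)%N by rewrite prednK.
have lead : (('X - gamma%:P) ^+ m)`_m = 1.
  by have := monicP (monic_exp m (monicXsubC gamma)); rewrite lead_coefE size_exp_XsubC.
have vbS : vb (m * N) = hx V *m vb (m * N).-1 by rewrite /vb -iterS prednK.
rewrite big_ord_recr /= lead scale1r addn0 [(N * m)%N]mulnC vbS.
rewrite (vb_delta jm) (hx_col jm).
have -> : col (Ordinal jm) (hx V) =
    \sum_(l < m * N) if (N %| l)%N then Valpha gamma m (l %/ N) *: vb l else 0.
  apply/colP => i; rewrite summxE !mxE /= prednK // ltnn (bigD1 i) //= big1 ?addr0 => [|l li].
    by case: ifP => _; rewrite ?mxE // vb_delta // !mxE eqxx mulr1.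
  by case: ifP => _; rewrite ?mxE // vb_delta // !mxE eq_sym val_eqE (negbTE li) mulr0.
rewrite (sum_dvdn (fun l => Valpha gamma m (l %/ N) *: vb l)) // -big_split big1 //= => l _.
by rewrite mulnK // /Valpha scaleNr addn0 [(N * l)%N]mulnC subrr.
Qed.

End CyclicBasis.

(** * Polynomial model of the tensor product *)

Section TensorColumns.
Variables (k : fieldType) (m n : nat).

Definition tcol (x : 'cV[k]_m) (y : 'cV[k]_n) : 'cV[k]_(m * n) := x *t y.

Lemma tcolE x y i j : tcol x y (mxtens_index (i, j)) 0 = x i 0 * y j 0.
Proof. by rewrite mxE mxtens_indexK /= !ord1. Qed.

Lemma mul_tcol (A : 'M[k]_m) (B : 'M[k]_n) x y :
  (A *t B) *m tcol x y = tcol (A *m x) (B *m y).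
Proof. exact: (@tensmx_mul k m m n n 1 1). Qed.

Lemma tcol_linl c x x' y : tcol (c *: x + x') y = c *: tcol x y + tcol x' y.
Proof.
by apply/colP => l; case: (mxtens_indexP l) => i j; rewrite !mxE mulrDl mulrA.
Qed.

Lemma tcol_linr c x y y' : tcol x (c *: y + y') = c *: tcol x y + tcol x y'.
Proof.
by apply/colP => l; case: (mxtens_indexP l) => i j; rewrite !mxE mulrDr mulrCA.
Qed.

Lemma tcol0l y : tcol 0 y = 0. Proof. exact: (@tens0mx _ _ 1 _ 1). Qed.
Lemma tcol0r x : tcol x 0 = 0. Proof. exact: (@tensmx0 _ _ 1 _ 1). Qed.

Lemma tcolZ c d x y : tcol (c *: x) (d *: y) = (c * d) *: tcol x y.
Proof.
have := tcol_linl c x 0 (d *: y); rewrite addr0 tcol0l addr0 => ->.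
by have := tcol_linr d x y 0; rewrite addr0 tcol0r addr0 => ->; rewrite scalerA.
Qed.

Lemma tcol_suml (I : Type) (r : seq I) (c : I -> k) (x : I -> 'cV[k]_m) y :
  tcol (\sum_(i <- r) c i *: x i) y = \sum_(i <- r) c i *: tcol (x i) y.
Proof.
elim: r => [|i r IH]; first by rewrite !big_nil tcol0l.
by rewrite !big_cons tcol_linl IH.
Qed.

Lemma tcol_sumr (I : Type) (r : seq I) (c : I -> k) x (y : I -> 'cV[k]_n) :
  tcol x (\sum_(i <- r) c i *: y i) = \sum_(i <- r) c i *: tcol x (y i).
Proof.
elim: r => [|i r IH]; first by rewrite !big_nil tcol0r.
by rewrite !big_cons tcol_linr IH.
Qed.

Lemma tcol_span (L : 'cV[k]_(m * n) -> Prop) : L 0 ->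
  (forall c w w', L w -> L w' -> L (c *: w + w')) ->
  (forall i j, L (tcol (delta_mx i 0) (delta_mx j 0))) -> forall w, L w.
Proof.
move=> L0 LD Ld w; rewrite [w]matrix_sum_delta.
elim/big_rec: _ => // l w' _; rewrite big_ord1 => Lw'; apply: LD => //.
case: (mxtens_indexP l) => i j; have := Ld i j; congr L.
apply/colP => l'; case: (mxtens_indexP l') => i' j'; rewrite tcolE !mxE !eqxx !andbT.
rewrite (can_eq (@mxtens_indexK m n)) -pair_eqE /=.
by case: eqP; case: eqP; rewrite ?mulr1 ?mulr0 ?mul0r.
Qed.

End TensorColumns.

Section TensorModel.
Variables (k : closedFieldType) (G : groupType) (a : G) (chi sigma lam : G -> k).
Variables (s s' n t : nat) (theta eta : k).
Local Notation N := (s * s')%N.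
Hypotheses (n0 : (0 < n)%N) (t0 : (0 < t)%N) (N0 : (0 < N)%N).
Hypothesis chiN : forall g, chi g ^+ N = 1.

Local Notation M1 := (Vmod2 chi sigma N (theta ^+ s') n).
Local Notation M2 := (Vmod2 chi lam N (eta ^+ s') t).
Local Notation T := (htens a M1 M2).
Local Notation C := {poly {poly k}}.
Local Notation cst := (cst k).
Local Notation X := (Xop cst 'X%:P 'X (@scale2 k) (lam a) (chi a)).

Definition tphi : C -> 'cV[k]_(hdim T) := lext2 (fun i j =>
  tcol (vb chi sigma N (theta ^+ s') n i) (vb chi lam N (eta ^+ s') t j)).

Lemma tphi_lin c f g : tphi (cst c * f + g) = c *: tphi f + tphi g.
Proof. exact: lext2_lin. Qed.

Lemma tphi0 : tphi 0 = 0.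
Proof. exact: lext2_0. Qed.

Lemma tphi_mono i j : tphi ('X%:P ^+ i * 'X ^+ j) =
  tcol (vb chi sigma N (theta ^+ s') n i) (vb chi lam N (eta ^+ s') t j).
Proof. exact: lext2_mono. Qed.

Lemma tphi_X f : tphi (X f) = hx T *m tphi f.
Proof.
move: f; apply: linear_ext.
- by rewrite /Xop rmorph0 !mulr0 addr0 tphi0.
- by rewrite tphi0 mulmx0.
- move=> c x y; rewrite Xop_lin ?tphi_lin //; exact: scale2_cst.
- by move=> c x y; rewrite tphi_lin mulmxDr scalemxAr.
move=> i j.
have -> : X ('X%:P ^+ i * 'X ^+ j) = cst (lam a * chi a ^+ j) * ('X%:P ^+ i.+1 * 'X ^+ j)
    + 'X%:P ^+ i * 'X ^+ j.+1.
  rewrite /Xop !(rmorphM, rmorphXn) scale2_u scale2_v rmorph1 mul1r /= exprMn !exprS; ring.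
rewrite tphi_lin !tphi_mono mulmxDl !mul_tcol mul1mx (vb_weight _ _ _ chiN).
congr (_ + _); rewrite -[vb _ _ _ _ _ i.+1]/(hx M1 *m vb _ _ _ _ _ i).
have := tcolZ 1 (chi a ^+ j * lam a) (hx M1 *m vb chi sigma N (theta ^+ s') n i) (vb chi lam N (eta ^+ s') t j).
by rewrite scale1r mul1r mulrC => ->.
Qed.

Lemma tphi_iterX m f : tphi (iter m X f) = iter m (mulmx (hx T)) (tphi f).
Proof. by elim: m => //= m <-; exact: tphi_X. Qed.

Lemma tphi_rho g f :
  hrho T g *m tphi f = char_mul sigma lam g *: tphi (scale2 (chi g) (chi g) f).
Proof.
move: f; apply: linear_ext.
- by rewrite tphi0 mulmx0.
- by rewrite rmorph0 tphi0 scaler0.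
- by move=> c x y; rewrite tphi_lin mulmxDr scalemxAr.
- move=> c x y; rewrite rmorphD rmorphM scale2_cst tphi_lin scalerDr !scalerA.
  by rewrite mulrC.
move=> i j; rewrite tphi_mono mul_tcol !(vb_weight _ _ _ chiN) tcolZ.
have -> : scale2 (chi g) (chi g) ('X%:P ^+ i * 'X ^+ j) =
    cst (chi g ^+ i * chi g ^+ j) * ('X%:P ^+ i * 'X ^+ j) + 0.
  rewrite !(rmorphM, rmorphXn) scale2_u scale2_v /= !exprMn; ring.
rewrite tphi_lin tphi0 addr0 tphi_mono scalerA /char_mul; congr (_ *: _); ring.
Qed.

(** On images of monomials, multiplication by [A^n] or [B^t] applies the defining relation to one
    tensor factor. *)
Lemma tphi_inI f : inI cst 'X%:P 'X s s' n t theta eta f -> tphi f = 0.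
Proof.
move=> [x [y ->]].
have hA z : tphi (('X%:P ^+ (s * s') - cst (theta ^+ s')) ^+ n * z) = 0.
  pose g z := tphi (('X%:P ^+ (s * s') - cst (theta ^+ s')) ^+ n * z).
  apply: (linear_ext (g := g) (g' := fun=> 0)).
  - by rewrite /g mulr0 tphi0.
  - by [].
  - by move=> c x' y'; rewrite /g mulrDr mulrCA tphi_lin.
  - by move=> c _ _; rewrite scaler0 addr0.
  move=> i j; rewrite /g -(ev_XsubC cst) ev_poly mulr_suml size_exp_XsubC.
  rewrite -[RHS](tcol0l _ (vb chi lam N (eta ^+ s') t j)) -(vb_rel chi sigma (theta ^+ s') N0 i n0).
  rewrite tcol_suml.
  elim/big_rec2: _ => [|l y1 y2 _ <-]; first exact: tphi0.
  by rewrite -mulrA tphi_lin -exprM mulrA -exprD tphi_mono.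
have hB z : tphi (('X ^+ (s * s') - cst (eta ^+ s')) ^+ t * z) = 0.
  pose g z := tphi (('X ^+ (s * s') - cst (eta ^+ s')) ^+ t * z).
  apply: (linear_ext (g := g) (g' := fun=> 0)).
  - by rewrite /g mulr0 tphi0.
  - by [].
  - by move=> c x' y'; rewrite /g mulrDr mulrCA tphi_lin.
  - by move=> c _ _; rewrite scaler0 addr0.
  move=> i j; rewrite /g -(ev_XsubC cst) ev_poly mulr_suml size_exp_XsubC.
  rewrite -[RHS](tcol0r _ (vb chi sigma N (theta ^+ s') n i)) -(vb_rel chi lam (eta ^+ s') N0 j t0).
  rewrite tcol_sumr.
  elim/big_rec2: _ => [|l y1 y2 _ <-]; first exact: tphi0.
  by rewrite -mulrA tphi_lin -exprM mulrCA -exprD tphi_mono.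
have := tphi_lin 1 (('X%:P ^+ (s * s') - cst (theta ^+ s')) ^+ n * x)
  (('X ^+ (s * s') - cst (eta ^+ s')) ^+ t * y).
by rewrite rmorph1 mul1r hA hB scale1r addr0 => ->.
Qed.

Lemma tphi_span (L : 'cV[k]_(hdim T) -> Prop) : L 0 ->
  (forall c w w', L w -> L w' -> L (c *: w + w')) ->
  (forall f, L (tphi f)) -> forall w, L w.
Proof.
move=> L0 LD Lf; apply: (tcol_span L0 LD) => i j.
have := Lf ('X%:P ^+ i * 'X ^+ j); rewrite tphi_mono !vb_delta //; try exact: ltn_ord.
by congr (L (tcol _ _)); apply/colP => l; rewrite !mxE eqxx andbT -val_eqE.
Qed.

(** Checked on the images of polynomials, which exhaust [T], where it says that [X] raises the
    degree by one. *)
Lemma htens_comm g : hrho T g *m hx T = chi g *: (hx T *m hrho T g).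
Proof.
suff h (w : 'cV[k]_(hdim T)) : (hrho T g *m hx T) *m w = (chi g *: (hx T *m hrho T g)) *m w.
  by apply/matrixP => i j; move/colP/(_ i): (h (delta_mx j 0)); rewrite -!colE !mxE.
move: w; apply: tphi_span.
- by rewrite !mulmx0.
- move=> c w w'; move: (hrho T g *m hx T) (chi g *: _) => A B hw hw'.
  by rewrite !mulmxDr -!scalemxAr hw hw'.
move=> f; rewrite -scalemxAl -!mulmxA -tphi_X !tphi_rho -scalemxAr -tphi_X.
rewrite (Xop_homog (iota := cst) (u := 'X%:P) (v := 'X)); last exact: bivariate_span.
- rewrite -[cst _ * _]addr0 tphi_lin tphi0 addr0 !scalerA; congr (_ *: _); exact: mulrC.
- exact: scale2_cst.
- exact: scale2_u.
- exact: scale2_v.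
Qed.

End TensorModel.

(** [X^n - 1] is separable in characteristic zero, and [n] distinct [n]-th roots of unity include a
    primitive one. *)
Lemma prim_root_exists (k : closedFieldType) n : [pchar k] =i pred0 -> (0 < n)%N ->
  exists z : k, n.-primitive_root z.
Proof.
move=> k0 n0; have [r rE] := closed_field_poly_normal ('X^n - 1 : {poly k}).
have lc : lead_coef ('X^n - 1 : {poly k}) = 1 by rewrite lead_coefXnsubC.
rewrite lc scale1r in rE.
have ur : uniq r.
  by rewrite -separable_prod_XsubC -rE separable_Xn_sub_1 // natr_neq0.
have sr : size r = n.
  by apply: succn_inj; rewrite -(size_prod_XsubC _ id) -rE size_XnsubC.
have /hasP [z _ zn] : has n.-primitive_root r.
  apply: has_prim_root => //; last by rewrite sr.
  by apply/allP => z zr; rewrite /root_of_unity rE root_prod_XsubC.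
by exists z.
Qed.

Lemma finite_choice (A : Type) (a0 : A) (P : nat -> A -> Prop) m :
  (forall j, (j < m)%N -> exists x, P j x) -> exists f, forall j, (j < m)%N -> P j (f j).
Proof.
elim: m => [|m IH] h; first by exists (fun=> a0).
have [j jm|f fP] := IH; first by apply: h; exact: ltnW.
have [x xP] := h m (ltnSn m).
exists (fun j => if j == m then x else f j) => j; rewrite ltnS leq_eqVlt.
by case: eqP => [-> _ //|_] /=; apply: fP.
Qed.

(** * Covers of the tensor product by the indecomposable summands *)

Section Final.
Variables (k : closedFieldType) (k_char0 : [pchar k] =i pred0).
Variables (G : groupType) (a : G) (chi sigma lam : G -> k) (s s' n t : nat) (theta eta zeta : k).
Local Notation N := (s * s')%N.
Hypotheses (n0 : (0 < n)%N) (t0 : (0 < t)%N).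
Hypothesis chiN : forall g, chi g ^+ N = 1.
Hypothesis qs : s.-primitive_root (chi a).
Hypothesis zetaN : N.-primitive_root zeta.
Hypotheses (la0 : lam a != 0) (theta0 : theta != 0) (eta0 : eta != 0).
Variable p : nat -> {poly k}.
Hypothesis pP : forall j, (j < n)%N -> (j < t)%N ->
  [/\ (size (p j) <= j.+1)%N, (p j).[-1] != 0 &
   forall i, (i < n)%N -> (n <= i + j)%N -> (('X + 1) ^+ (n + t - 1 - 2 * j) * p j)`_i = 0].

Local Notation M1 := (Vmod2 chi sigma N (theta ^+ s') n).
Local Notation M2 := (Vmod2 chi lam N (eta ^+ s') t).
Local Notation T := (htens a M1 M2).
Local Notation C := {poly {poly k}}.
Local Notation cst := (cst k).
Local Notation sl := (char_mul sigma lam).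
Local Notation Phi := (tphi a chi sigma lam s s' n t theta eta).
Local Notation X := (Xop cst 'X%:P 'X (@scale2 k) (lam a) (chi a)).
Local Notation S := (cst (lam a ^+ s) * 'X%:P ^+ s + 'X ^+ s).
Local Notation g1 := (gen1 cst 'X%:P 'X (@scale2 k) (lam a) (chi a) zeta s s' n t theta p).
Local Notation g0 := (gen0 cst 'X%:P 'X (@scale2 k) (lam a) zeta s s' n t theta p).
Local Notation c0 z := (lam a ^+ s * theta + z).
Local Notation D j := (n + t - 1 - 2 * j)%N.

Let N0 : (0 < N)%N. Proof. exact: prim_order_gt0 zetaN. Qed.
Let s0 : (0 < s)%N. Proof. exact: prim_order_gt0 qs. Qed.

Let bspan := @bivariate_span k.
Let b1 := @scale2_cst k.
Let b2 := @scale2_u k.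
Let b3 := @scale2_v k.

(** The degree modulo [N] becomes the weight. *)
Lemma tphi_weight c f g : homogc cst (@scale2 k) N c f ->
  hrho T g *m Phi f = char_mul (char_exp chi c) sl g *: Phi f.
Proof.
move=> hf; rewrite tphi_rho // (hf _ (chiN g)).
have := tphi_lin a chi sigma lam s s' n t theta eta (chi g ^+ c) f 0.
by rewrite !addr0 tphi0 addr0 => ->; rewrite scalerA mulrC.
Qed.

Lemma hcover_gen1 z r j : z ^+ s' = eta ^+ s' -> (r < s)%N -> (j < n)%N -> (j < t)%N ->
  hcover (Vmod2 chi sl N (c0 z ^+ s') (D j)) (eq (Phi (g1 z r j))).
Proof.
move=> zE rs jn jt; apply: hcover_Vmod2 => //; last 2 first.
- by rewrite subn_gt0; move: jn jt; clear; lia.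
- have Ig := gen1_ann b1 b2 b3 bspan (lam a) qs zetaN theta pP r zE jn jt.
  rewrite -[RHS](tphi_inI a chi sigma lam n0 t0 N0 Ig) -(ev_XsubC cst (S ^+ s') _ _) ev_poly mulr_suml size_exp_XsubC.
  elim/big_rec2: _ => [|l y1 y2 _ ->]; first by rewrite tphi0.
  rewrite -mulrA tphi_lin -exprM -(iterX_S b1 b2 b3 bspan (lam a) qs).
  by rewrite -tphi_iterX // mulnA.
- by move=> g; apply: htens_comm.
- move=> g; have h0 := gen1_hom b1 b2 b3 bspan (lam a) (chi a) n t zetaN theta p z j rs.
  by rewrite (tphi_weight g h0) /char_exp /char_mul expr0 mul1r.
Qed.

Lemma hcover_gen0 z r c j : z ^+ s' = eta ^+ s' -> c0 z = 0 -> (j < n)%N -> (j < t)%N ->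
  hcover (Vmod chi (char_mul (char_exp chi (r + s * c)) sl) (D j * s)) (eq (Phi (g0 z r c j))).
Proof.
move=> zE z0 jn jt; apply: hcover_Vmod => //.
- by move=> g; apply: htens_comm.
- move=> g; have h0 := gen0_hom b1 b2 b3 bspan (lam a) n t zetaN theta p z r c j.
  by rewrite (tphi_weight g h0).
- by rewrite muln_gt0 s0 andbT; move: jn jt; clear; lia.
have Ig := gen0_ann b1 b2 b3 bspan qs zetaN pP r c zE jn jt z0.
by rewrite [(D j * s)%N]mulnC -tphi_iterX // (tphi_inI a chi sigma lam n0 t0 N0 Ig).
Qed.

(** [gens_span] applied to the preimage of [L] in [k[u, v]]. *)
Lemma tensor_generated (L : 'cV[k]_(hdim T) -> Prop) : L 0 ->
  (forall c w w', L w -> L w' -> L (c *: w + w')) ->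
  (forall w, L w -> L (hx T *m w)) ->
  (forall z, z ^+ s' = eta ^+ s' -> forall r j, (r < s)%N -> (j < n)%N -> (j < t)%N ->
    if c0 z == 0 then forall c, (c < s')%N -> L (Phi (g0 z r c j)) else L (Phi (g1 z r j))) ->
  forall w, L w.
Proof.
move=> L0 LD LX Lg; apply: (tphi_span L0 LD) => f.
apply: (gens_span k_char0 b1 b2 b3 bspan la0 qs zetaN theta0 eta0 pP (L := fun f => L (Phi f))).
- split=> [|c x y Lx Ly]; first by rewrite tphi0.
  by rewrite tphi_lin; apply: LD.
- by move=> x Lx; rewrite tphi_X //; apply: LX.
- by move=> x Ix; rewrite (tphi_inI a chi sigma lam n0 t0 N0 Ix).
- exact: Lg.
Qed.

End Final.

(** * Families of summands and their index sets *)

Lemma hcover_copies (k : fieldType) (G : groupType) (V T : hmod k G) r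
    (gens : nat -> 'cV[k]_(hdim T) -> Prop) :
  (forall i, (i < r)%N -> hcover V (gens i)) ->
  hcover (hcopies r V) (fun w => exists2 i, (i < r)%N & gens i w).
Proof.
move=> h; rewrite /hcopies (_ : nseq r V = [seq V | i <- iota 0 r]); last first.
  by elim: r 0%N {h} => //= r IH m; rewrite -IH.
apply: hcover_sub (hcover_map (r := iota 0 r) (f := fun=> V) (gens := gens) _) => [w [i ir gw]|i].
  by exists i; rewrite ?mem_iota.
by rewrite mem_iota; apply: h.
Qed.

Lemma hcover_allpairs (k : fieldType) (G : groupType) (I J : eqType) (r : seq I) (r' : seq J)
    (V : I -> J -> hmod k G) (T : hmod k G) (gens : I -> J -> 'cV[k]_(hdim T) -> Prop) :
  (forall i j, i \in r -> j \in r' -> hcover (V i j) (gens i j)) ->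
  hcover (hbigsum [seq V i j | i <- r, j <- r'])
    (fun w => exists i j, [/\ i \in r, j \in r' & gens i j w]).
Proof.
move=> h.
rewrite -[[seq V i j | i <- r, j <- r']](map_allpairs (fun x => V x.1 x.2) pair).
apply: hcover_sub (hcover_map (gens := fun x => gens x.1 x.2) _) => [w [i [j [ir jr gw]]]|x].
  by exists (i, j) => //; apply: allpairs_f.
by move=> /allpairsP [[i j] /= [ir jr ->]]; apply: h.
Qed.

Lemma hdim_copies (k : fieldType) (G : groupType) (V : hmod k G) r :
  hdim (hcopies r V) = (r * hdim V)%N.
Proof. by rewrite hdim_hbigsum; elim: r => [|r IH]; rewrite ?big_nil // big_cons IH. Qed.

(** With [m = min(n, t)] and [c = |n - t|] the sum is [m (m + c)], and [m + c = max(n, t)]. *)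
Lemma sum_clebsch_gordan (n t : nat) :
  (\sum_(i <- iota 1 (minn n t)) (2 * i - 1 + (maxn n t - minn n t)) = n * t)%N.
Proof.
have h c m : (\sum_(i <- iota 1 m) (2 * i - 1 + c) = m * (m + c))%N.
  elim: m => [|m IH]; first by rewrite big_nil.
  by rewrite -(addn1 m) iotaD big_cat IH /= big_cons big_nil; lia.
by rewrite h /minn /maxn; case: ltnP => nt; rewrite subnKC ?(ltnW nt) //; lia.
Qed.

(** The summand with index [i] comes from the form of degree [min(n, t) - i]. *)
Lemma clebsch_gordan_index n t i : i \in iota 1 (minn n t) ->
  [/\ (minn n t - i < n)%N, (minn n t - i < t)%N &
      (2 * i - 1 + (maxn n t - minn n t) = n + t - 1 - 2 * (minn n t - i))%N].
Proof. by rewrite mem_iota => h; split; lia. Qed.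

Lemma clebsch_gordan_index_onto n t j : (j < n)%N -> (j < t)%N ->
  exists2 i, i \in iota 1 (minn n t) & (minn n t - i)%N = j.
Proof. by move=> jn jt; exists (minn n t - j)%N; rewrite ?mem_iota; lia. Qed.

Lemma sum_seq_const (I : Type) (r : seq I) c : \sum_(j <- r) c = (size r * c)%N.
Proof. by rewrite big_const_seq count_predT iter_addn_0 mulnC. Qed.

Theorem theorem3p10
  (k : closedFieldType) (k_char0 : [pchar k] =i pred0)
  (G : groupType) (a : G) (a_central : forall g : G, (a * g = g * a)%g)
  (chi : G -> k) (chi_char : is_character chi)
  (s sbar s' : nat)
  (hs1 : (1 < s)%N) (hs : s.-primitive_root (chi a))
  (hssbar : (s < sbar)%N) (hsbar : char_order chi sbar)
  (hs' : sbar = (s * s')%N)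
  (xi : k) (hxi : s'.-primitive_root xi)
  (n t : nat) (hn : (1 <= n)%N) (ht : (1 <= t)%N)
  (sigma lam : G -> k) (hsigma : is_character sigma) (hlam : is_character lam)
  (alpha beta : k) (halpha : alpha != 0) (hbeta : beta != 0)
  (theta eta : k) (htheta : theta ^+ s' = alpha) (heta : eta ^+ s' = beta) :
  let alphaj (j : nat) := (theta * lam a ^+ s + eta * xi ^+ j.-1) ^+ s' in
  let d (i : nat) := (2 * i - 1 + (maxn n t - minn n t))%N in
  let sl := char_mul sigma lam in
  let T := htens a (Vmod2 chi sigma sbar alpha n) (Vmod2 chi lam sbar beta t) in
  (beta + (-1) ^+ s'.+1 * alpha * lam a ^+ sbar != 0 ->
    hiso T (hbigsum [seq hcopies s (Vmod2 chi sl sbar (alphaj j) (d i))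
                    | i <- iota 1 (minn n t), j <- iota 1 s'])) /\
  (beta + (-1) ^+ s'.+1 * alpha * lam a ^+ sbar = 0 ->
    exists j0 : nat,
      [/\ (1 <= j0 <= s')%N, alphaj j0 = 0,
          (forall j, (1 <= j <= s')%N -> alphaj j = 0 -> j = j0)
        & hiso T
            (hdsum
              (hbigsum [seq hcopies s (Vmod2 chi sl sbar (alphaj j) (d i))
                       | i <- iota 1 (minn n t),
                         j <- [seq j <- iota 1 s' | j != j0]])
              (hbigsum [seq Vmod chi (char_mul (char_exp chi j) sl) (d i * s)
                       | i <- iota 1 (minn n t),
                         j <- iota 0 sbar]))]).
Proof.
move=> alphaj d sl T.
subst sbar alpha beta.
have s0 := prim_order_gt0 hs.
have s'0 := prim_order_gt0 hxi.
have N0 : (0 < s * s')%N by rewrite muln_gt0 s0.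
have [zeta zetaN] := prim_root_exists k_char0 N0.
have chiN : forall g, chi g ^+ (s * s') = 1 by case: hsbar => _ [].
have la0 : lam a != 0.
  apply/negP => /eqP la0; case: hlam => lM l1.
  by move/eqP: l1; rewrite -(mulgV a) lM la0 mul0r eq_sym oner_eq0.
have theta0 : theta != 0 by move: halpha; rewrite expf_eq0 s'0.
have eta0 : eta != 0 by move: hbeta; rewrite expf_eq0 s'0.
have [p pP] := finite_choice (0 : {poly k}) (fun j (jm : (j < minn n t)%N) =>
  lefschetz_poly k_char0 (leq_trans jm (geq_minl n t)) (leq_trans jm (geq_minr n t))).
have {}pP j : (j < n)%N -> (j < t)%N ->
  [/\ (size (p j) <= j.+1)%N, (p j).[-1] != 0 &
   forall i, (i < n)%N -> (n <= i + j)%N -> (('X + 1) ^+ (n + t - 1 - 2 * j) * p j)`_i = 0].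
  by move=> jn jt; apply: pP; rewrite leq_min jn.
(* The [z j] with [1 <= j <= s'] are the roots of [z^s' = beta], and [alphaj j] is the [s']-th power
   of [c0 (z j)]. *)
pose z j := eta * xi ^+ j.-1.
have zE j : z j ^+ s' = eta ^+ s'.
  by rewrite exprMn exprAC (prim_expr_order hxi) expr1n mulr1.
have zP x : x ^+ s' = eta ^+ s' -> exists2 j, j \in iota 1 s' & x = z j.
  move=> xE; have /(prim_rootP hxi) [j jE] : (x / eta) ^+ s' = 1.
    by rewrite expr_div_n xE divff // expf_neq0.
  exists j.+1; first by rewrite mem_iota add1n !ltnS ltn_ord.
  by rewrite /z /= -jE mulrC divfK.
have alphaE j : alphaj j = (lam a ^+ s * theta + z j) ^+ s' by rewrite /alphaj [_ * theta]mulrC.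
have dE := @clebsch_gordan_index n t.
have z_inj i j : i \in iota 1 s' -> j \in iota 1 s' -> z i = z j -> i = j.
  rewrite !mem_iota => hi hj /(mulfI eta0) /eqP; rewrite (eq_prim_root_expr hxi).
  by rewrite !modn_small; move: hi hj; clear; lia.
have c0P j : (lam a ^+ s * theta + z j == 0) =
    (alphaj j == 0) by rewrite alphaE expf_eq0 s'0.
pose Phi := tphi a chi sigma lam s s' n t theta eta.
pose g1 x r i := Phi (gen1 (cst k) 'X%:P 'X (@scale2 k) (lam a) (chi a) zeta s s' n t theta p x r (minn n t - i)).
pose g0 x r c i := Phi (gen0 (cst k) 'X%:P 'X (@scale2 k) (lam a) zeta s s' n t theta p x r c (minn n t - i)).
have cov1 i j : i \in iota 1 (minn n t) ->
    hcover (hcopies s (Vmod2 chi sl (s * s') (alphaj j) (d i)))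
      (fun w : 'cV[k]_(hdim T) => exists2 r, (r < s)%N & g1 (z j) r i = w).
  move=> /dE [jn jt]; rewrite -/(d i) => ->; apply: (hcover_copies (gens := fun r => eq (g1 (z j) r i))) => r rs.
  by rewrite alphaE; apply: (hcover_gen1 _ _ _ hn ht chiN hs zetaN pP).
have cov0 i j j0 : i \in iota 1 (minn n t) -> alphaj j0 = 0 ->
    hcover (Vmod chi (char_mul (char_exp chi j) sl) (d i * s))
      (fun w : 'cV[k]_(hdim T) => g0 (z j0) (j %% s)%N (j %/ s)%N i = w).
  move=> /dE [jn jt]; rewrite -/(d i) => -> j00.
  (* The index [j < s s'] of a nilpotent summand encodes the pair [(r, c)] as [r + s c]. *)
  have {1}-> : (j = j %% s + s * (j %/ s))%N by rewrite addnC mulnC -divn_eq.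
  by apply: (hcover_gen0 _ hn ht chiN hs zetaN pP) => //; apply/eqP; rewrite c0P j00.
have cgi := @clebsch_gordan_index_onto n t.
have powN : (- (lam a ^+ s * theta)) ^+ s' = (-1) ^+ s' * (lam a ^+ (s * s') * theta ^+ s').
  by rewrite (exprNn (lam a ^+ s * theta)) exprMn -exprM.
split=> [ne|e].
(* If [z j = - lam(a)^s theta], then taking [s']-th powers gives
   [beta = (-1)^s' alpha lam(a)^(s s')], against the assumption. *)
- have al0 j : lam a ^+ s * theta + z j != 0.
    apply: contra_neq ne => /eqP; rewrite addr_eq0 => /eqP zj.
    have := zE j; rewrite -[z j]opprK -zj powN => <-.
    rewrite exprS; ring.
  apply: hcover_iso (hcover_allpairs (fun i j ii _ => cov1 i j ii)) _.
    (* Both sides have dimension [n t (s s')^2]. *)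
    rewrite hdim_hbigsum big_allpairs_dep /=.
    rewrite (eq_bigr (fun i => d i * (s' * s * (s * s')))%N) => [|i _].
      by rewrite -big_distrl /= sum_clebsch_gordan mulnACA [(s' * s)%N]mulnC -mulnACA.
    rewrite (eq_bigr (fun=> s * (d i * (s * s'))))%N => [|j _]; last by rewrite hdim_copies.
    by rewrite sum_seq_const size_iota mulnA mulnCA mulnA.
  move=> L L0 LD LX Lg; apply: (tensor_generated k_char0 hn ht chiN hs zetaN la0 theta0 eta0 pP L0 LD LX).
  move=> x /zP [j js ->] r i0 rs i0n i0t; rewrite (negbTE (al0 j)).
  have [i ii <-] := cgi i0 i0n i0t.
  by apply: Lg; exists i, j; split; [exact: ii | exact: js | exists r].
have [j0 j0s j00] : exists2 j0, j0 \in iota 1 s' & alphaj j0 = 0.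
  (* The assumption says that [- lam(a)^s theta] is itself a root of [z^s' = beta]. *)
  have [|j0 j0s zj] := zP (- (lam a ^+ s * theta)).
    move/eqP: e; rewrite addr_eq0 => /eqP ->.
    rewrite powN exprS; ring.
  by exists j0 => //; apply/eqP; rewrite -c0P -zj subrr.
have uniq0 j : j \in iota 1 s' -> alphaj j = 0 -> j = j0.
  move=> js /eqP; rewrite -c0P addrC addr_eq0 => /eqP zj.
  move/eqP: j00; rewrite -c0P addrC addr_eq0 => /eqP zj0.
  by apply: z_inj => //; rewrite zj zj0.
exists j0; split => //.
- by move: j0s; rewrite mem_iota add1n ltnS.
- by move=> j js; apply: uniq0; rewrite mem_iota add1n ltnS.
apply: hcover_iso (hcover_dsum (hcover_allpairs (fun i j ii _ => cov1 i j ii))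
  (hcover_allpairs (fun i j ii _ => cov0 i j j0 ii j00))) _.
  (* The summands with [j != j0] contribute [n t (s' - 1) s (s s')] and the nilpotent ones
     [n t (s s') s], in total [n t (s s')^2]. *)
  rewrite [LHS]/= !hdim_hbigsum !big_allpairs_dep /=.
  rewrite (eq_bigr (fun i => d i * (s'.-1 * s * (s * s')))%N) => [|i _].
    rewrite -big_distrl /= sum_clebsch_gordan.
    rewrite (eq_bigr (fun i => d i * (s * s' * s))%N) => [|i _].
      rewrite -big_distrl /= sum_clebsch_gordan; move: s'0; clear; case: s' => // m _.
      by rewrite /=; ring.
    by rewrite sum_seq_const size_iota mulnCA.
  rewrite (eq_bigr (fun=> s * (d i * (s * s'))))%N => [|j _]; last by rewrite hdim_copies.
  rewrite sum_seq_const size_filter.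
  have := count_predC (pred1 j0) (iota 1 s'); rewrite count_uniq_mem ?iota_uniq // j0s size_iota.
  rewrite /= => cE; have -> : count (fun j => j != j0) (iota 1 s') = s'.-1.
    by rewrite -[in RHS]cE.
  by rewrite mulnA mulnCA mulnA.
move=> L L0 LD LX Lg; apply: (tensor_generated k_char0 hn ht chiN hs zetaN la0 theta0 eta0 pP L0 LD LX).
move=> x /zP [j js ->] r i0 rs i0n i0t.
have [i ii <-] := cgi i0 i0n i0t.
case: ifP => [|/negbT cz].
  rewrite c0P => /eqP /(uniq0 j js) -> c cs'.
  apply: Lg; right; exists i, (c * s + r)%N; split; first exact: ii.
    by rewrite mem_iota /= add0n mulnC; move: rs cs'; clear; nia.
  have -> : ((c * s + r) %% s = r)%N by rewrite modnMDl modn_small.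
  have -> : ((c * s + r) %/ s = c)%N by rewrite divnMDl // divn_small // addn0.
  exact: erefl.
apply: Lg; left; exists i, j; split; [exact: ii | | by exists r].
rewrite mem_filter js andbT; apply: contra_neq cz => ->.
by apply/eqP; rewrite c0P j00.
Qed.
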